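(* Suppose that $(x_i)$ is a normalized weakly null sequence in a Banach space $X$ which has a spreading model $(\tilde x_i)$ that is not equivalent to the unit vector basis of $\ell_1$. Assume that $1$ belongs to the Krivine set of $(\tilde x_i)$. Then for every sequence $(\lambda_n)\subset\mathbb{R}$ with $\lambda_n\nearrow\infty$ and $\lim_n \frac{n}{\lambda_n}=\infty$ there is a block sequence $(y_n)$ of $(x_n)$ having a spreading model $(\tilde y_n)$ which satisfies $$\limsup_n\frac{n}{\|\sum_{i=1}^n\tilde y_i\|}=\limsup_n\frac{\|\sum_{i=1}^n\tilde y_i\|}{\lambda_n}=\infty .$$ Moreover, the set of all spreading models in $X$ which are generated by weakly null sequences and are not equivalent to the unit vector basis of $\ell_1$ has no maximal element with respect to domination.
   Context: Banach spaces are real. A seminormalized sequence $(x_i)$ in a Banach space has (generates) the spreading model $(\tilde x_i)$, where $(\tilde x_i)$ is a basic sequence in some Banach space, if for some sequence $\varepsilon_n\searrow 0$ one has, for all $n\in\mathbb{N}$, all $(a_i)_{i=1}^n\in[-1,1]^n$ and all integers $n\le k_1<\dots<k_n$, $$\left|\Big\|\sum_{i=1}^n a_i x_{k_i}\Big\|-\Big\|\sum_{i=1}^n a_i\tilde x_i\Big\|\right|<\varepsilon_n .$$ The Krivine set of a 1-subsymmetric basic sequence $(x_i)$ (as every spreading model of a weakly null sequence is) is the set of all $p\in[1,\infty]$ such that for all $\varepsilon>0$ and $n\in\mathbb{N}$ there exist $m\in\mathbb{N}$ and $(\lambda_k)_{k=1}^m\subset\mathbb{R}$ such that for all $(a_i)_{i=1}^n\subset\mathbb{R}$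 $$\frac1{1+\varepsilon}\|(a_i)_{i=1}^n\|_p\le\Big\|\sum_{i=1}^na_iy_i\Big\|\le(1+\varepsilon)\|(a_i)_{i=1}^n\|_p,\qquad y_i=\sum_{k=1}^m\lambda_kx_{(i-1)m+k}\ (i=1,\dots,n),$$ where $\|\cdot\|_p$ is the $\ell_p$ norm. A basic sequence $(x_i)$ dominates $(y_i)$, written $(x_i)\ge(y_i)$, if there is $C\ge1$ with $C\|\sum a_ix_i\|\ge\|\sum a_iy_i\|$ for all finitely supported scalar sequences $(a_i)$. Write $(x_i)>(y_i)$ if $(x_i)\ge(y_i)$ and $(y_i)\not\ge(x_i)$. The spreading models in $X$ considered in the last assertion are those generated by normalized weakly null basic sequences in $X$; equivalent ones are identified, so that $\ge$ is a partial order. *)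

(* Defs.v *)
(* Sequences of vectors are indexed from 0: [x n] is the (n+1)-st term. *)
From HB Require Import structures.
From mathcomp Require Export all_boot all_order all_algebra.
From mathcomp Require Export all_classical all_reals all_analysis.
Export Order.TTheory GRing.Theory Num.Theory.
Export numFieldNormedType.Exports.

Set Implicit Arguments.
Unset Strict Implicit.
Unset Printing Implicit Defensive.

#[global] Open Scope classical_set_scope.
#[global] Open Scope ring_scope.

Section BasicSequences.
Context {R : realType} {E : normedModType R}.
Implicit Types x y : nat -> E.

Definition lin_span x : set E :=
  [set v | exists n (a : 'I_n -> R), v = \sum_(i < n) a i *: x i].

(* Schauder basis of its closed linear span *)
Definition basic_sequence x : Prop :=
  forall v : E, closure (lin_span x) v ->
    exists! a : nat -> R, series (fun i => a i *: x i) @ \oo --> v.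

Definition normalized x : Prop := forall n, `|x n| = 1.

Definition seminormalized x : Prop :=
  exists c C : R, 0 < c /\ forall n, c <= `|x n| <= C.

Definition weakly_null x : Prop :=
  forall f : {linear E -> R^o}, continuous f -> (fun n => f (x n)) @ \oo --> (0 : R^o).

Definition block_sequence x y : Prop :=
  exists (k : nat -> nat) (a : nat -> R),
    (forall n, (k n < k n.+1)%N) /\
    (forall n, y n = \sum_(k n <= i < k n.+1) a i *: x i /\ y n != 0).

Definition comb_norm x n (a : 'I_n -> R) : R := `|\sum_(i < n) a i *: x i|.

End BasicSequences.

(* The junk value at -oo is never used: exponents are required to be >= 1. *)
Definition lp_norm {R : realType} (p : \bar R) n (a : 'I_n -> R) : R :=
  match p with
  | r%:E => (\sum_(i < n) `|a i| `^ r) `^ r^-1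
  | +oo%E => \big[Num.max/0]_(i < n) `|a i|
  | -oo%E => 0
  end.

(* The condition n <= k_1 refers to 1-based indices, whence [(k i).+1]. *)
Definition spreading_model {R : realType} {X E : normedModType R}
    (x : nat -> X) (e : nat -> E) : Prop :=
  seminormalized x /\ basic_sequence e /\
  exists eps : nat -> R,
    (forall m n, (m <= n)%N -> eps n <= eps m) /\
    eps @ \oo --> (0 : R) /\
    forall n, (0 < n)%N -> forall (a : 'I_n -> R) (k : 'I_n -> nat),
      (forall i, -1 <= a i <= 1) ->
      (forall i j : 'I_n, (i < j)%N -> (k i < k j)%N) ->
      (forall i, (n <= (k i).+1)%N) ->
      `| `|\sum_(i < n) a i *: x (k i)| - `|\sum_(i < n) a i *: e i| | < eps n.

Definition krivine_set {R : realType} {E : normedModType R} (x : nat -> E) :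
    set (\bar R) :=
  [set p | (1%:E <= p)%E /\
    forall eps : R, 0 < eps -> forall n, (0 < n)%N ->
      exists m (lam : 'I_m -> R), (0 < m)%N /\
        let y (i : nat) := \sum_(k < m) lam k *: x (i * m + k)%N in
        forall a : 'I_n -> R,
          (1 + eps)^-1 * lp_norm p a <= `|\sum_(i < n) a i *: y i| /\
          `|\sum_(i < n) a i *: y i| <= (1 + eps) * lp_norm p a].

(* Domination only involves the norms of finite linear combinations, so it is
   defined on the induced functions of finitely many coefficients; for the unit
   vector basis of l_1 this function is [lp_norm 1]. *)
Definition norm_dominates {R : realType} (N M : forall n, ('I_n -> R) -> R) : Prop :=
  exists C : R, 1 <= C /\ forall n (a : 'I_n -> R), M n a <= C * N n a.

Definition dominates {R : realType} {E F : normedModType R}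
    (x : nat -> E) (y : nat -> F) : Prop :=
  norm_dominates (comb_norm x) (comb_norm y).

Definition strictly_dominates {R : realType} {E F : normedModType R}
    (x : nat -> E) (y : nat -> F) : Prop :=
  dominates x y /\ ~ dominates y x.

Definition equivalent_l1 {R : realType} {E : normedModType R} (x : nat -> E) : Prop :=
  norm_dominates (comb_norm x) (@lp_norm R 1%:E) /\
  norm_dominates (@lp_norm R 1%:E) (comb_norm x).

Definition wn_spreading_model_not_l1 {R : realType} (X : normedModType R)
    {E : normedModType R} (e : nat -> E) : Prop :=
  (exists x : nat -> X,
     normalized x /\ weakly_null x /\ basic_sequence x /\ spreading_model x e) /\
  ~ equivalent_l1 e.

(* Maximality up to equivalence; the competitors [f] live in arbitrary Banach spaces. *)
Definition maximal_spreading_model {R : realType} (X : normedModType R)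
    {E : normedModType R} (e : nat -> E) : Prop :=
  wn_spreading_model_not_l1 X e /\
  forall (F : completeNormedModType R) (f : nat -> F),
    wn_spreading_model_not_l1 X f -> ~ strictly_dominates f e.

(* Main.v *)
From HB Require Import structures.
Require Import Defs.
From mathcomp Require Import ring lra zify.

(** Let N(a) be the norm that the spreading model of a weakly null sequence gives
    to a finite coefficient sequence a, that is, the limit of the norms of
    a_1 x_(l_1) + ... + a_n x_(l_n) as the indices move to infinity.  Replacing one
    term by small convex combinations of the sequence (Mazur) shows that
    deleting coefficients never increases N ([asym_suppress]).  Averaging
    translates of a then gives |sum a| N(1,...,1) <= (m + n) N(a), where there are
    n coefficients and m ones, so that either N is equivalent to the l_1 norm or
    N(1,...,1) is o(m) ([asym_average], [not_l1_sublinear]).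

    For the first assertion choose, for r = 0, 1, 2, ..., a number n_r so large
    that n_r / lambda(n_r) >= 4 r 2^r, and coefficients of a block in the spreading
    model of x whose first n_r consecutive translates behave like the basis of
    l_1^(n_r).  Let y_j be the sum over r <= j of 2^-r times a copy of the r-th block
    in x, with all these copies successive and y_0, y_1, ... far apart.  For fixed R
    the blocks r < R form a fixed finite pattern, and the others contribute
    O(2^-R) uniformly in j.  So y is weakly null, and a spreading model of a
    subsequence has ||sum_(i<n) y~_i|| <= A_R ||sum_(i<n) x~_i|| + 6 n 2^-R, which is
    o(n) ([block_norm_upper]); deleting all blocks but the r-th shows
    ||sum_(i<n_r) y~_i|| >= 2^-r n_r / 4 >= r lambda(n_r) ([block_norm_lower]).
    These estimates are collected in [krivine_blocks].

    For the second assertion let e be a spreading model that is not l_1, generated by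
    x'.  The first construction with lambda(n) = ||sum_(i<n) e_i|| + sqrt n gives a
    weakly null y whose spreading model is not dominated by e.  Stabilizing the pair
    (x', y) and adding terms of x' and y in alternation gives a weakly null s whose
    asymptotic norm dominates those of x' and y (delete every second term) and is at
    most their sum, so it is not l_1 ([joint_upper_bound]).  After normalizing s and
    passing to a basic subsequence, its spreading model strictly dominates e.

    Three classical tools are developed on the way.  Separation of convex sets by
    functionals comes from minimal sublinear functionals ([convex_separation]).
    The Brunel-Sucheston theorem is proved with iterated limits along an
    ultrafilter in place of Ramsey's theorem ([brunel_sucheston]).  The Banach space
    carrying a spreading model is the space of all scalar sequences whose initial
    segments have bounded norm ([seqspace], [spreading_model_exists]). *)

Set Implicit Arguments.
Unset Strict Implicit.
Unset Printing Implicit Defensive.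

(** * Separation of convex sets by functionals *)

Section Sublinear.
Context {R : realType} {X : normedModType R}.
Implicit Types (q : X -> R) (C : set X).

Definition sublinear q : Prop :=
  (forall u v, q (u + v) <= q u + q v) /\
  (forall (t : R) v, 0 <= t -> q (t *: v) = t * q v).

(** The largest sublinear functional below [q] whose value at [- c] is at most [- d]
    for all [c] in a convex set [C].  It serves twice: with [C] a singleton it shows
    that minimal sublinear functionals are odd, and with [q] the norm it turns a
    lower bound of the norm on [C] into a separating functional. *)
Definition push q C (d : R) (v : X) : R :=
  inf [set r | exists (t : R) (c : X), [/\ 0 <= t, C c & r = q (v + t *: c) - t * d]].

Lemma sublinear0 q : sublinear q -> q 0 = 0.
Proof. by move=> [_ qZ]; rewrite -(scale0r (0 : X)) qZ // mul0r. Qed.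

Lemma sublinear_opp q v : sublinear q -> - q (- v) <= q v.
Proof.
move=> q_sub; have := q_sub.1 v (- v).
by rewrite subrr sublinear0 // => ?; rewrite lerNl; lra.
Qed.

Section Push.
Context (q : X -> R) (C : set X) (d : R).
Hypotheses (q_sub : sublinear q) (C_ne : C !=set0).
Hypothesis C_convex : forall c c' (s t : R), C c -> C c' -> 0 < s -> 0 < t ->
  s + t = 1 -> C (s *: c + t *: c').
Hypothesis q_ge : forall c, C c -> d <= q c.

(** The infimum in [push] is finite: subadditivity bounds [q (t *: c)] from above and
    the hypothesis [d <= q c] bounds it from below. *)
Lemma push_lb v t c : 0 <= t -> C c -> - q (- v) <= q (v + t *: c) - t * d.
Proof.
move=> t0 Cc; have : q (t *: c) <= q (v + t *: c) + q (- v).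
  by rewrite (le_trans _ (q_sub.1 _ _)) // addrC addKr.
rewrite q_sub.2 // => h; have := ler_wpM2l t0 (q_ge Cc); lra.
Qed.

Lemma push_has_inf v :
  has_inf [set r | exists (t : R) (c : X), [/\ 0 <= t, C c & r = q (v + t *: c) - t * d]].
Proof.
split; first by case: C_ne => c Cc; exists (q (v + 0 *: c) - 0 * d), 0, c.
by exists (- q (- v)) => _ [t [c [t0 Cc ->]]]; exact: push_lb.
Qed.

Lemma push_le v t c : 0 <= t -> C c -> push q C d v <= q (v + t *: c) - t * d.
Proof.
by move=> t0 Cc; apply: ge_inf; [case: (push_has_inf v) | exists t, c].
Qed.

Lemma push_ge v r :
  (forall t c, 0 <= t -> C c -> r <= q (v + t *: c) - t * d) -> r <= push q C d v.
Proof.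
move=> h; apply: lb_le_inf; first by case: (push_has_inf v).
by move=> _ [t [c [t0 Cc ->]]]; exact: h.
Qed.

Lemma push_le_self v : push q C d v <= q v.
Proof.
case: C_ne => c Cc; have := push_le v (lexx 0) Cc.
by rewrite scale0r addr0 mul0r subr0.
Qed.

Lemma push_opp c : C c -> push q C d (- c) <= - d.
Proof.
move=> Cc; have := push_le (- c) ler01 Cc.
by rewrite scale1r addNr sublinear0 // mul1r sub0r.
Qed.

(** Subadditivity is where convexity of [C] enters: [t *: c + s *: c'] is
    [t + s] times a convex combination of [c] and [c']. *)
Lemma push_sublinear : sublinear (push q C d).
Proof.
split=> [u v|t v].
  rewrite -lerBlDr; apply: push_ge => t c t0 Cc.
  rewrite lerBlDr -lerBlDl; apply: push_ge => s c' s0 Cc'; rewrite lerBlDl.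
  have [->|tN0] := eqVneq t 0.
    rewrite scale0r addr0 mul0r subr0.
    apply: le_trans (push_le _ s0 Cc') _.
    by rewrite -addrA; have := q_sub.1 u (v + s *: c'); lra.
  have [->|sN0] := eqVneq s 0.
    rewrite scale0r addr0 mul0r subr0.
    apply: le_trans (push_le _ t0 Cc) _.
    by rewrite addrAC; have := q_sub.1 (u + t *: c) v; lra.
  have tp : 0 < t by rewrite lt_def tN0.
  have sp : 0 < s by rewrite lt_def sN0.
  have stp : 0 < t + s by rewrite addr_gt0.
  have Ccc : C ((t / (t + s)) *: c + (s / (t + s)) *: c').
    by apply: C_convex; rewrite ?divr_gt0 // -mulrDl divff // gt_eqF.
  apply: le_trans (push_le _ (ltW stp) Ccc) _.
  rewrite scalerDr !scalerA !(mulrC (t + s)) !divfK ?gt_eqF //.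
  by rewrite addrACA; have := q_sub.1 (u + t *: c) (v + s *: c'); lra.
rewrite le_eqVlt => /predU1P[<-|t0].
  rewrite scale0r mul0r; apply/eqP; rewrite eq_le.
  rewrite (le_trans (push_le_self _)) ?(sublinear0 q_sub) //=.
  apply: push_ge => s c s0 Cc; rewrite add0r q_sub.2 // -mulrBr.
  by rewrite mulr_ge0 // subr_ge0 q_ge.
apply/eqP; rewrite eq_le; apply/andP; split.
  rewrite -ler_pdivrMl //; apply: push_ge => s c s0 Cc.
  rewrite ler_pdivrMl // mulrBr -q_sub.2 ?(ltW t0) // scalerDr scalerA mulrA.
  by apply: push_le; rewrite // mulr_ge0 // ltW.
apply: push_ge => s c s0 Cc; rewrite -ler_pdivlMl // mulrBr.
rewrite -q_sub.2 ?invr_ge0 ?(ltW t0) // scalerDr !scalerA mulVf ?gt_eqF // scale1r mulrA.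
by apply: push_le; rewrite // mulr_ge0 // invr_ge0 ltW.
Qed.

End Push.

Section Minimal.
Context (p : X -> R) (p_sub : sublinear p).

(** Zorn's lemma for the reversed pointwise order: the infimum of a chain stays finite
    because [q v >= - p (- v)] for every sublinear [q] below [p]. *)
Lemma exists_minimal_sublinear : exists q, [/\ sublinear q, forall v, q v <= p v &
  forall q', sublinear q' -> (forall v, q' v <= q v) -> q' = q].
Proof.
pose T := {q : X -> R | sublinear q /\ forall v, q v <= p v}.
pose Rel (q1 q2 : T) := `[< forall v, sval q2 v <= sval q1 v >].
have [] := @Zorn T Rel.
- by move=> q; apply/asboolP.
- move=> q1 q2 q3 /asboolP h1 /asboolP h2; apply/asboolP => v.
  exact: le_trans (h2 v) (h1 v).
- move=> [q1 H1] [q2 H2] /asboolP /= h1 /asboolP /= h2.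
  by apply/eq_exist/funext => v; apply/eqP; rewrite eq_le h1 h2.
- move=> A totA; have [[q0 Aq0]|A0] := pselect (A !=set0); last first.
    have pp : sublinear p /\ forall v, p v <= p v by split.
    by exists (exist (fun q => sublinear q /\ forall v, q v <= p v) p pp) => s As; case: A0; exists s.
  pose V v : set R := [set r | exists2 q : T, A q & r = sval q v].
  have V_inf v : has_inf (V v).
    split; first by exists (sval q0 v); exists q0.
    exists (- p (- v)) => _ [q Aq ->]; have [qs qp] := svalP q.
    by have := sublinear_opp v qs; have := qp (- v); lra.
  have V_le v (q : T) : A q -> inf (V v) <= sval q v.
    by move=> Aq; apply: ge_inf; [case: (V_inf v) | exists q].
  have V_ge v r : (forall q : T, A q -> r <= sval q v) -> r <= inf (V v).
    move=> h; apply: lb_le_inf; first by case: (V_inf v).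
    by move=> _ [q Aq ->]; exact: h.
  have qP : sublinear (fun v => inf (V v)) /\ forall v, inf (V v) <= p v.
    split; last by move=> v; apply: le_trans (V_le v _ Aq0) _; case: (svalP q0).
    split=> [u v|t v].
      rewrite -lerBlDr; apply: (V_ge) => q1 Aq1.
      rewrite lerBlDr -lerBlDl; apply: (V_ge) => q2 Aq2; rewrite lerBlDl.
      have [/asboolP h|/asboolP h] := totA _ _ Aq1 Aq2.
        have := V_le (u + v) _ Aq2; have [[+ _] _] := svalP q2 => /(_ u v).
        by have := h u; lra.
      have := V_le (u + v) _ Aq1; have [[+ _] _] := svalP q1 => /(_ u v).
      by have := h v; lra.
    rewrite le_eqVlt => /predU1P[<-|t0].
      rewrite scale0r mul0r; apply/eqP; rewrite eq_le; apply/andP; split.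
        apply: le_trans (V_le _ _ Aq0) _.
        by rewrite sublinear0 //; case: (svalP q0).
      by apply: (V_ge) => q _; rewrite sublinear0 //; case: (svalP q).
    apply/eqP; rewrite eq_le; apply/andP; split.
      rewrite -ler_pdivrMl //; apply: (V_ge) => q Aq; rewrite ler_pdivrMl //.
      apply: le_trans (V_le _ _ Aq) _.
      by have [[_ qZ] _] := svalP q; rewrite qZ ?(ltW t0).
    apply: (V_ge) => q Aq; have [[_ qZ] _] := svalP q; rewrite qZ ?(ltW t0) //.
    by rewrite ler_pM2l // V_le.
  exists (exist (fun q => sublinear q /\ forall v, q v <= p v) _ qP) => q Aq.
  by apply/asboolP => v /=; exact: V_le.
- move=> q qmin; exists (sval q); case: (svalP q) => qs qp; split=> // q' q's q'q.
  have q'P : sublinear q' /\ forall v, q' v <= p v.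
    by split=> // v; exact: le_trans (q'q v) (qp v).
  have := qmin (exist (fun q => sublinear q /\ forall v, q v <= p v) q' q'P); move=> h.
  by rewrite -h //; apply/asboolP.
Qed.

(** A minimal sublinear [q] equals its own push along any [v], whose value at [- v] is
    at most [- q v].  Hence [q] is odd, and an odd sublinear functional is linear. *)
Theorem linear_minorant : exists f : {linear X -> R^o}, forall v, f v <= p v.
Proof.
have [q [q_sub qp qmin]] := exists_minimal_sublinear.
have qN v : q (- v) = - q v.
  apply/eqP; rewrite eq_le; apply/andP; split; last first.
    by have := sublinear_opp v q_sub; rewrite lerNl.
  have conv c c' (s t : R) : [set v] c -> [set v] c' -> 0 < s -> 0 < t ->
      s + t = 1 -> [set v] (s *: c + t *: c').
    by move=> /= -> -> _ _ st; rewrite -scalerDl st scale1r.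
  have ge c : [set v] c -> q v <= q c by move=> ->.
  have v0 : [set v] !=set0 by exists v.
  rewrite -{1}(qmin (push q [set v] (q v))); first exact: push_opp.
    exact: push_sublinear.
  by move=> u; exact: push_le_self.
have qD u v : q (u + v) = q u + q v.
  apply/eqP; rewrite eq_le q_sub.1 /=.
  have := q_sub.1 (u + v) (- v); rewrite addrK qN; lra.
have qZ (a : R) v : q (a *: v) = a * q v.
  have [a0|a0] := leP 0 a; first exact: q_sub.2.
  by rewrite -[a]opprK scaleNr qN q_sub.2 ?mulNr // oppr_ge0 ltW.
have qlin : linear (q : X -> R^o) by move=> a u v; rewrite qD qZ.
pose fM := GRing.isLinear.Build R X R^o *:%R (q : X -> R^o) qlin.
pose f : {linear X -> R^o} := HB.pack (q : X -> R^o) fM.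
by exists f.
Qed.

End Minimal.

Lemma dominated_linear_continuous (f : {linear X -> R^o}) (M : R) :
  (forall v, `|f v| <= M * `|v|) -> continuous f.
Proof.
move=> fM; apply: bounded_linear_continuous.
apply/linear_boundedP; near=> r => v; apply: le_trans (fM v) _.
by rewrite ler_wpM2r //; near: r; exact: nbhs_pinfty_ge.
Unshelve. all: by end_near. Qed.

(** Any linear functional below the push of the norm along [C] will do. *)
Theorem convex_separation C (d : R) : C !=set0 ->
  (forall c c' (s t : R), C c -> C c' -> 0 < s -> 0 < t ->
    s + t = 1 -> C (s *: c + t *: c')) ->
  (forall c, C c -> d <= `|c|) ->
  exists f : {linear X -> R^o}, [/\ continuous f, forall v, `|f v| <= `|v| &
    forall c, C c -> d <= f c].
Proof.
move=> C0 Cconv Cd.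
have nsub : sublinear (fun v : X => `|v|).
  by split=> [u v|t v t0]; [exact: ler_normD | rewrite normrZ ger0_norm].
have [f fp] := linear_minorant (push_sublinear nsub C0 Cconv Cd).
have fn v : f v <= `|v| := le_trans (fp v) (push_le_self nsub C0 Cd v).
have fnn v : `|f v| <= `|v|.
  by rewrite ler_norml fn lerNl -linearN -(normrN v) fn.
exists f; split => //.
  by apply: (@dominated_linear_continuous f 1) => v; rewrite mul1r.
move=> c Cc; have := le_trans (fp (- c)) (push_opp nsub C0 Cd Cc).
by rewrite linearN lerN2.
Qed.

Corollary norming_functional (v : X) :
  exists f : {linear X -> R^o}, [/\ continuous f, forall u, `|f u| <= `|u| & f v = `|v|].
Proof.
have [|||f [fc fn fv]] := @convex_separation [set v] `|v|.
- by exists v.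
- by move=> c c' s t /= -> -> _ _ st; rewrite -scalerDl st scale1r.
- by move=> c ->.
exists f; split=> //; apply/eqP; rewrite eq_le fv // andbT.
exact: le_trans (ler_norm _) (fn v).
Qed.

End Sublinear.

(** * Asymptotic norms and suppression *)

Definition sincr (l : nat -> nat) : Prop := forall i, (l i < l i.+1)%N.

Lemma sincr_lt l : sincr l -> {homo l : i j / (i < j)%N}.
Proof. by move=> h; apply: homo_ltn => //; exact: ltn_trans. Qed.

Lemma sincr_le l : sincr l -> {homo l : i j / (i <= j)%N}.
Proof. by move=> h; apply: homo_leq => //; [exact: leq_trans | move=> i; exact: ltnW]. Qed.

Lemma sincr_add l i j : sincr l -> (l i + j <= l (i + j))%N.
Proof.
move=> h; elim: j => [|j IH]; first by rewrite !addn0.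
by rewrite !addnS (leq_ltn_trans IH).
Qed.

Lemma sincr_ge l i : sincr l -> (i <= l i)%N.
Proof. by move=> h; apply: leq_trans (sincr_add 0 i h); exact: leq_addl. Qed.

Lemma sincr_comp k l : sincr k -> sincr l -> sincr (k \o l).
Proof. by move=> hk hl i /=; apply: sincr_lt. Qed.

(** The filter of strictly increasing index sequences that start late.  Limits along
    it are the limits in the definition of a spreading model. *)
Definition spread : set_system (nat -> nat) :=
  filter_from [set: nat] (fun K => [set l | sincr l /\ (K <= l 0)%N]).

#[global] Instance spread_filter : ProperFilter spread.
Proof.
apply: filter_from_proper; last first.
  by move=> K _; exists (addn K); split=> [i|]; rewrite ?addnS ?addn0.
apply: filter_from_filter; first by exists 0%N.
move=> K K' _ _; exists (maxn K K') => // l [hl]; rewrite geq_max => /andP[h h'].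
by split.
Qed.

Lemma near_spread (K : nat) : \forall l \near spread, sincr l /\ (K <= l 0)%N.
Proof. by exists K. Qed.

Lemma near_spreadP (P : (nat -> nat) -> Prop) (K : nat) :
  (forall l, sincr l -> (K <= l 0)%N -> P l) -> \forall l \near spread, P l.
Proof. by move=> h; exists K => // l [? ?]; exact: h. Qed.

Lemma spread_map (phi : (nat -> nat) -> nat -> nat) :
  (forall K, \forall l \near spread, sincr (phi l) /\ (K <= phi l 0)%N) ->
  phi @ spread --> spread.
Proof.
move=> h A [K _ KA]; have := h K; rewrite /= /nbhs /=; apply: filterS => l.
exact: KA.
Qed.

Lemma spread_comp k : sincr k -> (fun (l : nat -> nat) => k \o l) @ spread --> spread.
Proof.
move=> hk; apply: spread_map => K; apply: (near_spreadP (K := K)) => l hl Kl.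
by split; [exact: sincr_comp | exact: leq_trans Kl (sincr_ge _ hk)].
Qed.

Lemma spread_shift s : (fun (l : nat -> nat) i => l (s + i)%N) @ spread --> spread.
Proof.
apply: spread_map => K; apply: (near_spreadP (K := K)) => l hl Kl.
split=> [i|]; first by rewrite addnS; exact: hl.
by rewrite addn0; have := sincr_add 0 s hl; rewrite add0n; lia.
Qed.

Section Mazur.
Context {R : realType} {X : normedModType R}.

(** Mazur's lemma.  If all convex combinations of a tail had norm at least [delta],
    a separating functional would be at least [delta] on all terms of the tail.
    Weights are compared on all long enough ranges [q < m], so that combinations of
    different lengths can be mixed without reindexing. *)
Lemma mazur (x : nat -> X) (K : nat) (delta : R) : weakly_null x -> 0 < delta ->
  exists (T : nat) (mu : nat -> R), [/\ forall q, 0 <= mu q,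
    \sum_(q < T) mu q = 1 & `|\sum_(q < T) mu q *: x (K + q)%N| < delta].
Proof.
move=> x_wn delta0; apply: contrapT => hN.
pose C : set X := [set v | exists (mu : nat -> R) T, (forall q, 0 <= mu q) /\
  forall m, (T <= m)%N -> \sum_(q < m) mu q = 1 /\
    v = \sum_(q < m) mu q *: x (K + q)%N].
have Cx q : C (x (K + q)%N).
  exists (fun i => (i == q)%:R), q.+1; split=> [i|m qm]; first exact: ler0n.
  split; rewrite (bigD1 (Ordinal qm)) //= eqxx ?scale1r big1 ?addr0 // => i;
    rewrite -val_eqE /= => /negPf ->//; exact: scale0r.
have [|||f [fc fn fC]] := @convex_separation _ _ C delta.
- by exists (x (K + 0)%N).
- move=> c c' s t [mu [T [mu0 muT]]] [mu' [T' [mu'0 mu'T]]] s0 t0 st.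
  exists (fun q => s * mu q + t * mu' q), (maxn T T'); split=> [q|m].
    by rewrite addr_ge0 // mulr_ge0 // ltW.
  rewrite geq_max => /andP[/muT[h1 ->] /mu'T[h2 ->]]; split.
    by rewrite big_split /= -!mulr_sumr h1 h2 !mulr1.
  rewrite !scaler_sumr -big_split /=; apply: eq_bigr => i _.
  by rewrite scalerDl !scalerA.
- move=> c [mu [T [mu0 muT]]]; rewrite leNgt; apply/negP => h.
  by case: (muT T (leqnn _)) => h1 h2; apply: hN; exists T, mu; rewrite -h2.
have /cvgrPdist_lt/(_ _ delta0) := x_wn f fc.
case=> N _ /(_ (K + N)%N); rewrite /= leq_addl => /(_ isT).
rewrite sub0r normrN; apply/negP; rewrite -leNgt.
exact: le_trans (fC _ (Cx N)) (ler_norm _).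
Qed.

End Mazur.

Lemma cvg_eq_lim {R : realType} {T : Type} {F : set_system T} {FF : ProperFilter F}
  (f g : T -> R) (l l' : R) :
  f @ F --> l -> g @ F --> l' -> f =1 g -> l = l'.
Proof.
by move=> fl gl' /funext fg; apply: (cvg_unique (@Rhausdorff R) fl); rewrite fg.
Qed.

Lemma le_lim {R : realType} {T : Type} {F : set_system T} {FF : ProperFilter F}
  (f g : T -> R) (l l' : R) :
  f @ F --> l -> g @ F --> l' -> (\forall x \near F, f x <= g x) -> l <= l'.
Proof.
move=> fl gl' fg; apply/ler_addgt0Pr => e e0.
have e2 : 0 < e / 2 by rewrite divr_gt0.
have /cvgrPdist_le/(_ _ e2) h := fl; have /cvgrPdist_le/(_ _ e2) h' := gl'.
have [x [[hx h'x] fgx]] := filter_ex (filterI (filterI h h') fg).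
by move: hx h'x; rewrite /= !ler_norml; lra.
Qed.

Section AsymptoticNorm.
Context {R : realType} {X : normedModType R} {I : Type}.
Implicit Types (x : I -> nat -> X) (t : nat -> I) (a : nat -> R).

(** Several sequences are stabilized at once: the pattern [t] says that the [i]-th term
    of the combination comes from the sequence [x (t i)].  The joint version is what
    controls the sum of two sequences; for a single one, [I] is [unit]. *)
Definition asymptotic_norm x (N : nat -> (nat -> I) -> (nat -> R) -> R) : Prop :=
  forall n t a, (fun l : nat -> nat => `|\sum_(i < n) a i *: x (t i) (l i)|) @ spread --> N n t a.

Context (x : I -> nat -> X) (N : nat -> (nat -> I) -> (nat -> R) -> R).
Hypothesis xN : asymptotic_norm x N.

Lemma asym_comp n t a phi : phi @ spread --> spread ->
  (fun l : nat -> nat => `|\sum_(i < n) a i *: x (t i) (phi l i)|) @ spread --> N n t a.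
Proof. by move=> h; exact: (cvg_comp _ _ h (@xN n t a)). Qed.

Lemma asym_ext n t t' a a' : (forall i, (i < n)%N -> t i = t' i /\ a i = a' i) ->
  N n t a = N n t' a'.
Proof.
move=> h; apply: (cvg_eq_lim (@xN n t a) (@xN n t' a')).
by move=> l; congr `|_|; apply: eq_bigr => i _; have [-> ->] := h i (ltn_ord i).
Qed.

Lemma asym_ge0 n t a : 0 <= N n t a.
Proof.
apply: (le_lim (cvg_cst (0 : R)) (@xN n t a)).
by apply: nearW => l.
Qed.

Lemma asymD n t a b : N n t (fun i => a i + b i) <= N n t a + N n t b.
Proof.
apply: (le_lim (@xN n t _) (cvgD (@xN n t a) (@xN n t b))).
apply: nearW => l /=; under eq_bigr do rewrite scalerDl.
by rewrite big_split ler_normD.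
Qed.

Lemma asymZ n t (c : R) a : N n t (fun i => c * a i) = `|c| * N n t a.
Proof.
apply: (cvg_eq_lim (@xN n t _) (cvgM (cvg_cst `|c|) (@xN n t a))) => l /=.
rewrite -normrZ scaler_sumr; congr `|_|.
by apply: eq_bigr => i _; rewrite scalerA.
Qed.

Lemma asym_sum n t (J : nat) (b : nat -> nat -> R) :
  N n t (fun i => \sum_(s < J) b s i) <= \sum_(s < J) N n t (b s).
Proof.
elim: J => [|J IH].
  rewrite big_ord0 (_ : (fun _ => _) = fun i => 0 * 0 : R); last first.
    by apply/funext => i; rewrite big_ord0 mul0r.
  by rewrite asymZ normr0 mul0r.
rewrite big_ord_recr /=; apply: le_trans (lerD IH (lexx _)).
apply: le_trans (asymD _ _ _ _).
rewrite (@asym_ext _ t t _ (fun i => \sum_(s < J) b s i + b J i)) // => i _.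
by rewrite big_ord_recr.
Qed.

(** Dropping the first [s] indices of a late increasing sequence leaves a late
    increasing sequence, whence translation invariance of the limit. *)
Lemma asym_shift s n t a :
  N n (fun i => t (s + i)%N) (fun i => a (s + i)%N) =
  N (s + n)%N t (fun i => if (s <= i)%N then a i else 0).
Proof.
have h1 := @asym_comp n (fun i => t (s + i)%N) (fun i => a (s + i)%N) _ (@spread_shift s).
apply: (cvg_eq_lim h1 (@xN _ _ _)) => l.
congr `|_|; rewrite big_split_ord /= [X in _ = X + _]big1 ?add0r.
  by apply: eq_bigr => i _; rewrite leq_addr.
by move=> i _; rewrite leqNgt ltn_ord scale0r.
Qed.

Lemma asym_pad n m t a : (n <= m)%N ->
  N n t a = N m t (fun i => if (i < n)%N then a i else 0).
Proof.
move=> nm; apply: (cvg_eq_lim (@xN n t _) (@xN m t _)) => l; congr `|_|.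
rewrite (big_ord_widen _ (fun i => a i *: x (t i) (l i)) nm) big_mkcond /=.
by apply: eq_bigr => i _; case: ifP => //; rewrite scale0r.
Qed.

Hypothesis x_wn : forall c, weakly_null (x c).

(** Let the [j]-th index run through a gap of length [T] while the others stay fixed,
    and average with weights for which the convex combination of the terms in the
    gap is small.  The [j]-th summand then almost disappears, while every
    combination in the average has norm close to [N n t a]. *)
Lemma asym_suppress1 n t a j : (j < n)%N ->
  N n t (fun i => if i == j then 0 else a i) <= N n t a.
Proof.
move=> jn; apply/ler_addgt0Pr => e e0.
have e3 : 0 < e / 3 by rewrite divr_gt0.
set a' := fun i => _.
have /cvgrPdist_le/(_ _ e3)[K1 _ HK1] := @xN n t a.
have /cvgrPdist_le/(_ _ e3)[K2 _ HK2] := @xN n t a'.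
pose K := maxn K1 K2.
have dp : 0 < e / 3 / (`|a j| + 1) by rewrite divr_gt0 // ltr_wpDl.
have [T [mu [mu0 mu1 muT]]] := mazur (K + j) (x_wn (t j)) dp.
pose l q i := if (i < j)%N then (K + i)%N else if i == j then (K + j + q)%N
              else (K + T + i)%N.
have l_sincr q : (q < T)%N -> sincr (l q).
  by move=> qT i; rewrite /l; case: (ltngtP i j); case: (ltngtP i.+1 j); lia.
have l_ge q : (K <= l q 0)%N by rewrite /l; case: ltngtP; lia.
pose w := \sum_(i < n) a' i *: x (t i) (l 0%N i).
pose u q := \sum_(i < n) a i *: x (t i) (l q i).
have uE q : u q = w + a j *: x (t j) (K + j + q)%N.
  rewrite /u /w (bigD1 (Ordinal jn)) //= [in RHS](bigD1 (Ordinal jn)) //=.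
  rewrite /a' eqxx scale0r add0r addrC /l ltnn eqxx; congr (_ + _).
  by apply: eq_bigr => i; rewrite -val_eqE /= => /negPf ->; case: ifP.
have [T0|T0] := posnP T.
  by move: mu1; rewrite T0 big_ord0 => /eqP; rewrite eq_sym oner_eq0.
have w_ge : N n t a' - e / 3 <= `|w|.
  have /HK2 : sincr (l 0%N) /\ (K2 <= l 0%N 0)%N.
    by split; [exact: l_sincr | exact: leq_trans (leq_maxr _ _) (l_ge _)].
  by rewrite ler_norml /w; lra.
have u_le q : (q < T)%N -> `|u q| <= N n t a + e / 3.
  move=> qT; have /HK1 : sincr (l q) /\ (K1 <= l q 0)%N.
    by split; [exact: l_sincr | exact: leq_trans (leq_maxl _ _) (l_ge _)].
  by rewrite ler_norml /u; lra.
have w_le : `|w| <= N n t a + e / 3 + e / 3.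
  have -> : w = \sum_(q < T) mu q *: u q - a j *: \sum_(q < T) mu q *: x (t j) (K + j + q)%N.
    under eq_bigr do rewrite uE scalerDr.
    rewrite big_split /= -scaler_suml mu1 scale1r scaler_sumr -addrA -sumrB big1 ?addr0 //.
    by move=> q _; rewrite !scalerA mulrC subrr.
  apply: le_trans (ler_normB _ _) _; apply: lerD.
    apply: le_trans (ler_norm_sum _ _ _) _.
    rewrite -[leRHS]mul1r -[X in _ <= X * _]mu1 mulr_suml; apply: ler_sum => q _.
    by rewrite normrZ ger0_norm // ler_wpM2l // u_le.
  rewrite normrZ; apply: le_trans (_ : `|a j| * (e / 3 / (`|a j| + 1)) <= _).
    by rewrite ler_wpM2l // ltW.
  rewrite mulrCA ger_pMr // ler_pdivrMr ?ltr_wpDl // mul1r.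
  by rewrite lerDl.
lra.
Qed.

Lemma asym_suppress n t a (A : pred nat) :
  N n t (fun i => if A i then a i else 0) <= N n t a.
Proof.
suff h m : (m <= n)%N -> N n t (fun i => if (i < m)%N && ~~ A i then 0 else a i) <= N n t a.
  rewrite (asym_ext (t' := t) (a' := fun i => if (i < n)%N && ~~ A i then 0 else a i)) ?h //.
  by move=> i ->; case: (A i).
elim: m => [|m IH] mn.
  by rewrite (asym_ext (t' := t) (a' := a)).
apply: le_trans (IH (ltnW mn)).
have [Am|Am] := boolP (A m).
  rewrite (asym_ext (t' := t) (a' := fun i => if (i < m)%N && ~~ A i then 0 else a i)) //.
  move=> i _; split=> //; rewrite ltnS leq_eqVlt.
  by case: eqP => //= ->; rewrite Am andbF.
apply: le_trans (asym_suppress1 t _ mn).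
rewrite (asym_ext (t' := t) (a' := fun i => if i == m then 0 else
   if (i < m)%N && ~~ A i then 0 else a i)) //.
move=> i _; split=> //; rewrite ltnS leq_eqVlt.
by case: eqP => //= ->; rewrite Am.
Qed.

Lemma asym_mono n m t a : (n <= m)%N -> N n t a <= N m t a.
Proof. by move=> nm; rewrite (asym_pad t a nm); exact: asym_suppress. Qed.

End AsymptoticNorm.

(** * Averages of translates and the l_1 alternative *)

(** With the index type [unit] there is only one way to assign a sequence to each
    term of a combination. *)
Local Notation single := (fun _ : nat => tt).

Section Average.
Context {R : realType} {X : normedModType R} {I : Type}.
Context (x : I -> nat -> X) (N : nat -> (nat -> I) -> (nat -> R) -> R).
Hypotheses (xN : asymptotic_norm x N) (x_wn : forall c, weakly_null (x c)).

(** Add up the [m + n] translates of [a] by [s < m + n]; each has norm [N n _ a].  At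
    the [m] positions from [n] to [n + m - 1] the sum equals the sum of all coefficients
    of [a], and suppression removes the other positions. *)
Lemma asym_average c n m (a : nat -> R) :
  `|\sum_(i < n) a i| * N m (fun _ => c) (fun _ => 1) <= (m + n)%:R * N n (fun _ => c) a.
Proof.
set t := fun _ => c; pose L := (m + n + n)%N.
pose b s j := \sum_(i < n) (s + i == j)%N%:R * a i.
have Nb s : (s < m + n)%N -> N L t (b s) = N n t a.
  move=> sm; rewrite -[in RHS](asym_ext xN (t := t) (t' := t)
     (a := fun i => a (s + i - s)%N)); last by move=> i _; rewrite addKn.
  rewrite (asym_shift xN s n t (fun i => a (i - s)%N)).
  rewrite [RHS](asym_pad xN (m := L)) ?/L; last by lia.
  apply: (asym_ext xN) => j jL; split=> //; rewrite /b.
  case: ifP => jsn; last first.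
    by rewrite big1 // => i _; rewrite (_ : _ == _ = false) ?mul0r //; have := ltn_ord i; lia.
  case: ifP => sj; last by rewrite big1 // => i _; rewrite (_ : _ == _ = false) ?mul0r //; lia.
  have jn : (j - s < n)%N by lia.
  rewrite (bigD1 (Ordinal jn)) //= subnKC // eqxx mul1r big1 ?addr0 // => i.
  rewrite -val_eqE /= => ij; rewrite (_ : _ == _ = false) ?mul0r //.
  by apply/negP => /eqP; move/eqP: ij; lia.
have bS j : (n <= j)%N -> (j < n + m)%N -> \sum_(s < m + n) b s j = \sum_(i < n) a i.
  move=> nj jnm; rewrite /b exchange_big /=; apply: eq_bigr => i _.
  have iL : (j - i < m + n)%N by lia.
  have in_ := ltn_ord i.
  rewrite -mulr_suml (bigD1 (Ordinal iL)) //= subnK; last by lia.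
  rewrite eqxx big1 ?addr0 ?mul1r // => s; rewrite -val_eqE /= => ij.
  by rewrite (_ : _ == _ = false) //; apply/negP => /eqP; move/eqP: ij; lia.
set S := \sum_(i < n) a i.
have -> : `|S| * N m t (fun _ => 1) =
    N L t (fun j => if (n <= j < n + m)%N then \sum_(s < m + n) b s j else 0).
  rewrite -(asymZ xN) (asym_shift xN n m t (fun=> S * 1)).
  rewrite [LHS](asym_pad xN (m := L)) ?/L; last by lia.
  apply: (asym_ext xN) => j jL; split=> //.
  by case: (leqP n j) => nj; case: ifP => //= jnm; rewrite bS ?mulr1.
apply: le_trans (asym_suppress xN x_wn _ _ _ _) _.
apply: le_trans (asym_sum xN _ _ _ _) _.
rewrite (eq_bigr (fun=> N n t a)) => [|s _]; last exact: Nb.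
by rewrite sumr_const card_ord mulr_natl.
Qed.

End Average.

Section SpreadingModel.
Context {R : realType} {X E : normedModType R}.

(** The norm of combinations of [e] in the shape of an asymptotic norm, so that
    spreading models and stable sequences are handled by the same lemmas. *)
Definition comb_asym (e : nat -> E) : nat -> (nat -> unit) -> (nat -> R) -> R :=
  fun n _ a => `|\sum_(i < n) a i *: e i|.

(** Padding by zeros makes the number of terms, and hence the accuracy, as large as
    desired; dividing by [A] brings arbitrary coefficients into the unit cube. *)
Lemma spreading_model_asymptotic (x : nat -> X) (e : nat -> E) :
  spreading_model x e -> asymptotic_norm (fun _ : unit => x) (comb_asym e).
Proof.
move=> [_ [_ [eps [eps_mono [eps0 epsP]]]]] n t a.
apply/cvgrPdist_le => d d0.
pose A := 1 + \sum_(i < n) `|a i|.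
have A0 : 0 < A by rewrite ltr_pwDl // sumr_ge0.
have /cvgrPdist_le/(_ (d / A)) := eps0.
case=> [|n1 _ /(_ n1 (leqnn _))]; first by rewrite divr_gt0.
rewrite sub0r normrN => epsn1.
pose m := (maxn n n1).+1.
have nm : (n <= m)%N by rewrite /m; lia.
apply: (near_spreadP (K := m)) => l hl ml.
pose b (i : 'I_m) : R := if (i < n)%N then a i / A else 0.
have bE (V : normedModType R) (v : nat -> V) :
    \sum_(i < m) b i *: v i = A^-1 *: \sum_(i < n) a i *: v i.
  rewrite [in RHS](big_ord_widen _ (fun i => a i *: v i) nm) [in RHS]big_mkcond /= scaler_sumr.
  apply: eq_bigr => i _; rewrite /b; case: ifP => _; last by rewrite scale0r scaler0.
  by rewrite scalerA mulrC.
have b1 i : -1 <= b i <= 1.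
  rewrite -ler_norml /b; case: ifP => [i_n|_]; last by rewrite normr0.
  rewrite normrM normfV (gtr0_norm A0) ler_pdivrMr // mul1r /A.
  by rewrite (bigD1 (Ordinal i_n)) //= addrCA lerDl addr_ge0 // sumr_ge0.
have li (i : 'I_m) : (m <= (l i).+1)%N.
  by apply: (leq_trans ml); apply: leqW; have := sincr_add 0 i hl; rewrite add0n; lia.
have := epsP m isT b (fun i => l i) b1 (fun i j => @sincr_lt l hl i j) li.
rewrite (bE X (fun i => x (l i))) (bE E e) !normrZ normfV (gtr0_norm A0) -mulrBr.
rewrite normrM normfV (gtr0_norm A0) mulrC ltr_pdivrMr // /comb_asym distrC => h.
apply: ltW; apply: lt_le_trans h _; rewrite -ler_pdivlMr //.
apply: le_trans (eps_mono n1 m _) (le_trans (ler_norm _) epsn1).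
by rewrite /m; lia.
Qed.

Definition extend n (a : 'I_n -> R) (i : nat) : R := oapp a 0 (insub i).

Lemma extendE n (a : 'I_n -> R) (i : 'I_n) : extend a i = a i.
Proof. by rewrite /extend valK. Qed.

Lemma lp_norm1E n (a : 'I_n -> R) : lp_norm 1%:E a = \sum_(i < n) `|a i|.
Proof.
rewrite /lp_norm invr1 powRr1; last by apply: sumr_ge0 => i _; exact: powR_ge0.
by apply: eq_bigr => i _; rewrite powRr1.
Qed.

(** If [N (1,...,1)] exceeds [d * m] for arbitrarily large [m], then [asym_average]
    bounds [|sum a|] by a multiple of [N a]; suppressing first the negative and then the
    nonnegative coefficients turns this into an l_1 lower estimate. *)
Lemma not_l1_sublinear (x : nat -> X) (e : nat -> E) : weakly_null x ->
  asymptotic_norm (fun _ : unit => x) (comb_asym e) -> ~ equivalent_l1 e ->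
  forall d : R, 0 < d -> exists n0, forall m, (n0 <= m)%N ->
    `|\sum_(i < m) e i| <= d * m%:R.
Proof.
move=> x_wn xe e_l1 d d0; apply: contrapT => hN; apply: e_l1.
have wn (c : unit) : weakly_null x by [].
have large n0 : exists2 m, (n0 <= m)%N & d * m%:R < `|\sum_(i < m) e i|.
  apply: contrapT => h; apply: hN; exists n0 => m n0m; rewrite leNgt.
  by apply/negP => h'; apply: h; exists m.
have sum_le n (a : nat -> R) : `|\sum_(i < n) a i| <= 2 / d * comb_asym e n single a.
  have [m nm dm] := large n.+1.
  have := asym_average xe wn tt n m a.
  rewrite {1}/comb_asym; under [X in _ * `|X| <= _]eq_bigr do rewrite scale1r.
  move=> h; have m0 : 0 < m%:R :> R by rewrite ltr0n; lia.
  have nmR : n%:R <= m%:R :> R by rewrite ler_nat; lia.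
  set S := `|\sum_(i < n) a i| in h *; set v := comb_asym e n single a.
  have v0 : 0 <= v := asym_ge0 xe _ _ _.
  have S0 : 0 <= S by exact: normr_ge0.
  have h1 : S * (d * m%:R) <= (m%:R + m%:R) * v.
    apply: le_trans (ler_wpM2l S0 (ltW dm)) (le_trans h _).
    by rewrite natrD ler_wpM2r // lerD2l.
  rewrite mulrAC ler_pdivlMr // -(ler_pM2r m0).
  by move: h1; rewrite mulrA; congr (_ <= _); ring.
have e_norm i : `|e i| = `|e 0%N|.
  have := asym_shift xe i 1 single (fun=> 1).
  rewrite /comb_asym big_ord1 scale1r big_split_ord /= big1 ?add0r.
    by rewrite big_ord1 /= leq_addr scale1r addn0.
  by move=> j _; rewrite leqNgt ltn_ord scale0r.
split.
  exists (1 + 4 / d); split=> [|n a].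
    by rewrite lerDl divr_ge0 // ltW.
  rewrite lp_norm1E /comb_norm.
  have -> : \sum_(i < n) a i *: e i = \sum_(i < n) extend a i *: e i.
    by apply: eq_bigr => i _; rewrite extendE.
  have -> : \sum_(i < n) `|a i| = \sum_(i < n) `|extend a i|.
    by apply: eq_bigr => i _; rewrite extendE.
  move: (extend a) => {}a.
  have h1 := le_trans (sum_le n (fun i => if 0 <= a i then a i else 0))
    (ler_wpM2l _ (asym_suppress xe wn n single a (fun i => 0 <= a i))).
  have h2 := le_trans (sum_le n (fun i => if ~~ (0 <= a i) then a i else 0))
    (ler_wpM2l _ (asym_suppress xe wn n single a (fun i => ~~ (0 <= a i)))).
  have d2 : 0 <= 2 / d by rewrite divr_ge0 // ltW.
  have {h1}h1 := h1 d2; have {h2}h2 := h2 d2.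
  have -> : \sum_(i < n) `|a i| = \sum_(i < n) (if 0 <= a i then a i else 0)
      - \sum_(i < n) (if ~~ (0 <= a i) then a i else 0).
    rewrite -sumrB; apply: eq_bigr => i _; case: (leP 0 (a i)) => ai /=.
      by rewrite subr0 ger0_norm.
    by rewrite sub0r ltr0_norm.
  rewrite /comb_asym in h1 h2 *.
  have := normr_ge0 (\sum_(i < n) a i *: e i).
  move: h1 h2; rewrite !ler_norml.
  have -> : 4 / d = 2 / d + 2 / d by rewrite -mulrDl; congr (_ / _); lra.
  rewrite mulrDl mul1r mulrDl; lra.
exists (1 + `|e 0%N|); split=> [|n a]; first by rewrite lerDl.
rewrite lp_norm1E /comb_norm; apply: le_trans (ler_norm_sum _ _ _) _.
rewrite mulr_sumr; apply: ler_sum => i _; rewrite normrZ e_norm mulrC ler_wpM2r //.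
by rewrite lerDr.
Qed.

End SpreadingModel.

(** * Stabilizing subsequences *)

Section Selection.

(** A grid of mesh [eta] has finitely many points in the cube, and the Lipschitz bound
    carries the estimates at its points to all other points. *)
Lemma cube_uniform {R : realType} {T : Type} {F : set_system T} {FF : Filter F}
  (G : T -> (nat -> R) -> R) (n : nat) (M A : R) : 0 <= M -> 0 <= A ->
  (forall k a b, G k a <= G k b + M * \sum_(i < n) `|a i - b i|) ->
  (forall a e, 0 < e -> \forall k \near F, G k a <= e) ->
  forall e, 0 < e -> \forall k \near F, forall a,
    (forall i, (i < n)%N -> `|a i| <= A) -> G k a <= e.
Proof.
move=> M0 A0 Glip Gpt e e0.
have e2 : 0 < e / 2 by rewrite divr_gt0.
have Mn0 : 0 < M * n%:R + 1 by rewrite ltr_wpDl // mulr_ge0.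
pose eta := e / 2 / (M * n%:R + 1).
have eta0 : 0 < eta by rewrite divr_gt0.
pose D := Num.truncn (2 * A / eta).
pose b (f : {ffun 'I_n -> 'I_D.+1}) (i : nat) : R :=
  if insub i is Some j then - A + eta * (f j)%:R else 0.
have : \forall k \near F, forall f, G k (b f) <= e / 2.
  by apply: filter_forall => f; exact: Gpt.
apply: filterS => k Gk a aA.
have round (i : 'I_n) : exists d : 'I_D.+1, `|a i - (- A + eta * d%:R)| <= eta.
  have := aA i (ltn_ord i); rewrite ler_norml => /andP[ai1 ai2].
  have u0 : 0 <= (a i + A) / eta by apply: divr_ge0; [lra | exact: ltW].
  have uD : (Num.truncn ((a i + A) / eta) < D.+1)%N.
    rewrite ltnS /D; apply: le_truncn.
    by rewrite ler_pM2r ?invr_gt0 //; lra.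
  exists (Ordinal uD) => /=; have /andP[] := truncn_itv u0.
  set d := Num.truncn _; rewrite ler_pdivlMr // ltr_pdivrMr // -natr1 => h1 h2.
  by rewrite ler_norml; apply/andP; split; lra.
have [f fP] := choice round.
apply: le_trans (Glip k a (b [ffun i => f i])) _.
rewrite [leRHS]splitr; apply: lerD; first exact: Gk.
apply: le_trans (_ : M * (n%:R * eta) <= _).
  rewrite ler_wpM2l //; apply: le_trans (_ : \sum_(i < n) eta <= _).
    by apply: ler_sum => i _; rewrite /b valK ffunE.
  by rewrite sumr_const card_ord mulr_natl.
rewrite mulrA /eta mulrCA ger_pMr // ler_pdivrMr // mul1r.
by rewrite lerDl.
Qed.

(** All selections of subsequences below have this form: given the indices
    chosen so far, almost every next index is admissible. *)
Lemma diagonal_sequence {F : set_system nat} {FF : ProperFilter F}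
  (C : seq nat -> set nat) : F `=>` \oo -> (forall h, F (C h)) ->
  exists k, sincr k /\ forall j, C (mkseq k j) (k j).
Proof.
move=> Foo FC.
have step h : exists k, C h k /\ forall q, q \in h -> (q < k)%N.
  have hF : F [set k | forall q, q \in h -> (q < k)%N].
    apply: Foo; exists (\max_(q <- h) q).+1 => // k /= hk q qh.
    by apply: leq_ltn_trans hk; apply: (leq_bigmax_seq (F := id)).
  by have [k [? ?]] := filter_ex (filterI (FC h) hF); exists k.
have [f fP] := choice step.
pose s j := iter j (fun h => rcons h (f h)) [::].
exists (fun j => f (s j)).
have sE j : mkseq (fun j => f (s j)) j = s j.
  by elim: j => // j IH; rewrite mkseqS IH.
split=> [i|j]; last by rewrite sE; case: (fP (s j)).
by apply: (fP (s i.+1)).2; rewrite /= mem_rcons mem_head.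
Qed.

End Selection.

Section UltrafilterLimit.
Context {R : realType} {U : set_system nat} {UU : UltraFilter U}.

Definition ulim (g : nat -> R) : R := sup [set r | U [set k | r <= g k]].

Lemma ulimP (g : nat -> R) (M : R) : (forall k, `|g k| <= M) -> g @ U --> ulim g.
Proof.
move=> gM; pose S := [set r | U [set k | r <= g k]].
have S_sup : has_sup S.
  split; first exists (- M).
    by apply: filterS filterT => k _ /=; have := gM k; rewrite ler_norml => /andP[].
  exists M => r Ur; have [k /= rk] := filter_ex Ur.
  by apply: le_trans rk (le_trans (ler_norm _) (gM k)).
apply/cvgrPdist_le => e e0.
have lo : U [set k | ulim g - e <= g k].
  have [r Sr lr] := sup_adherent e0 S_sup.
  by apply: filterS Sr => k /=; apply: le_trans; exact: ltW.
have hi : U (~` [set k | ulim g + e <= g k]).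
  have [h|//] := in_ultra_setVsetC [set k | ulim g + e <= g k] UU.
  have := ub_le_sup S_sup.2 h; rewrite -/(ulim g); lra.
apply: filterS (filterI lo hi) => k [/= h1 /negP]; rewrite -ltNge => h2.
by rewrite ler_norml; lra.
Qed.

End UltrafilterLimit.

Section IteratedLimit.
Context {R : realType} {X : normedModType R} {I : finType}.
Context {U : set_system nat} {UU : UltraFilter U}.
Context (x : I -> nat -> X) (B : R).
Hypotheses (B0 : 0 <= B) (xB : forall c k, `|x c k| <= B).

(** The iterated limit along [U], first index outermost, of the norm of
    [v + a 0 *: x (t 0) (k 0) + ... + a (n-1) *: x (t (n-1)) (k (n-1))]. *)
Fixpoint ilim n (t : nat -> I) (a : nat -> R) (v : X) : R :=
  if n is m.+1 then
    @ulim R U (fun k => ilim m (fun i => t i.+1) (fun i => a i.+1) (v + a 0%N *: x (t 0%N) k))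
  else `|v|.

Lemma ilim_bound n t a v : `|ilim n t a v| <= `|v| + B * \sum_(i < n) `|a i|.
Proof.
elim: n t a v => [|n IH] t a v /=; first by rewrite big_ord0 mulr0 addr0 normr_id.
have h k : `|ilim n (fun i => t i.+1) (fun i => a i.+1) (v + a 0%N *: x (t 0%N) k)| <=
    `|v| + B * \sum_(i < n.+1) `|a i|.
  apply: le_trans (IH _ _ _) _; rewrite big_ord_recl /= mulrDr addrA lerD2r.
  apply: le_trans (ler_normD _ _) _; rewrite lerD2l normrZ mulrC.
  exact: ler_wpM2r.
apply: (le_lim (cvg_norm (ulimP h)) (cvg_cst _)).
exact: nearW.
Qed.

Lemma ilim_cvg n t a v :
  (fun k => ilim n (fun i => t i.+1) (fun i => a i.+1) (v + a 0%N *: x (t 0%N) k)) @ U -->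
  ilim n.+1 t a v.
Proof.
apply: (@ulimP _ _ _ _ (`|v| + B * \sum_(i < n.+1) `|a i|)) => k.
apply: le_trans (ilim_bound _ _ _ _) _; rewrite big_ord_recl /= mulrDr addrA lerD2r.
apply: le_trans (ler_normD _ _) _; rewrite lerD2l normrZ mulrC.
exact: ler_wpM2r.
Qed.

Lemma ilim_lip n t a b v w :
  ilim n t a v <= ilim n t b w + (`|v - w| + B * \sum_(i < n) `|a i - b i|).
Proof.
elim: n t a b v w => [|n IH] t a b v w.
  by rewrite big_ord0 mulr0 addr0 /= -lerBlDl lerB_dist.
apply: (le_lim (@ilim_cvg n t a v) (cvgD (@ilim_cvg n t b w) (cvg_cst _))).
apply: nearW => k /=; apply: le_trans (IH _ _ (fun i => b i.+1) _ (w + b 0%N *: x (t 0%N) k)) _.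
rewrite lerD2l big_ord_recl /= mulrDr addrA lerD2r.
rewrite opprD addrACA -scalerBl; apply: le_trans (ler_normD _ _) _.
by rewrite lerD2l normrZ mulrC ler_wpM2r.
Qed.

Lemma ilim_ext n t t' a a' v : (forall i, (i < n)%N -> t i = t' i /\ a i = a' i) ->
  ilim n t a v = ilim n t' a' v.
Proof.
elim: n t t' a a' v => [//|n IH] t t' a a' v h /=.
have [-> ->] := h 0%N isT; congr ulim; apply/funext => k.
by apply: IH => i i_n; apply: h.
Qed.

(** The first [r] indices have been chosen, with terms [y i], and the limit is taken
    over the remaining [m]. *)
Definition partial_lim r m (y : nat -> X) t a : R :=
  ilim m (fun i => t (r + i)%N) (fun i => a (r + i)%N) (\sum_(i < r) a i *: y i).

Lemma partial_lim_lip r m y t a b : (forall i, `|y i| <= B) ->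
  partial_lim r m y t a <= partial_lim r m y t b + B * \sum_(i < r + m) `|a i - b i|.
Proof.
move=> yB; apply: le_trans (ilim_lip _ _ _ (fun i => b (r + i)%N) _
  (\sum_(i < r) b i *: y i)) _.
rewrite lerD2l big_split_ord /= mulrDr lerD2r -sumrB.
apply: le_trans (ler_norm_sum _ _ _) _; rewrite mulr_sumr; apply: ler_sum => i _.
by rewrite -scalerBl normrZ mulrC ler_wpM2r.
Qed.

Lemma partial_lim_ext r m y y' t t' a :
  (forall i, (i < r)%N -> y i = y' i) -> (forall i, (i < r + m)%N -> t i = t' i) ->
  partial_lim r m y t a = partial_lim r m y' t' a.
Proof.
move=> hy ht; rewrite /partial_lim.
have -> : \sum_(i < r) a i *: y i = \sum_(i < r) a i *: y' i.
  by apply: eq_bigr => i _; rewrite hy.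
by apply: ilim_ext => i im; split=> //; apply: ht; rewrite ltn_add2l.
Qed.

Definition extend_past r (y : nat -> X) (z : X) (i : nat) : X :=
  if i == r then z else y i.

Lemma partial_lim_step r m y t a :
  (fun k => partial_lim r.+1 m (extend_past r y (x (t r) k)) t a) @ U -->
  partial_lim r m.+1 y t a.
Proof.
suff -> : (fun k => partial_lim r.+1 m (extend_past r y (x (t r) k)) t a) =
    (fun k => ilim m (fun i => t (r + i.+1)%N) (fun i => a (r + i.+1)%N)
       (\sum_(i < r) a i *: y i + a (r + 0)%N *: x (t (r + 0)%N) k)).
  exact: (@ilim_cvg m (fun i => t (r + i)%N) (fun i => a (r + i)%N)).
apply/funext => k; rewrite /partial_lim !addn0.
congr (ilim _ _ _ _); try by apply/funext => i; rewrite addSnnS.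
rewrite big_ord_recr /= /extend_past eqxx; congr (_ + _).
by apply: eq_bigr => i _; rewrite ltn_eqF.
Qed.

(** The indices [k] that may follow the indices in [h]: using [k] as the next index,
    in place of the limit over it, changes every partial limit with at most
    [(size h).+1] terms and coefficients of size at most [(size h).+1] by little.
    The function [p] selects the earlier indices that occur in the combination. *)
Definition step_set (h : seq nat) : set nat :=
  [set k | forall r m t p a, (r + m <= size h)%N ->
    (forall i, (i < r.+1 + m)%N -> `|a i| <= (size h).+1%:R) ->
    let y i := x (t i) (nth 0%N h (p i)) in
    `|partial_lim r.+1 m (extend_past r y (x (t r) k)) t a - partial_lim r m.+1 y t a|
      <= 2^-1 ^+ (size h).+1].

(** For fixed patterns this is the definition of the limit, uniformly in the
    coefficients by [cube_uniform].  The condition sees [t] and [p] through finitely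
    many values, so that finite functions represent all patterns and selections. *)
Lemma step_set_near h : U (step_set h).
Proof.
pose j := size h.
have : \forall k \near U, forall (q : ('I_j.+1 * 'I_j.+1) *
   ({ffun 'I_j.+1 -> I} * {ffun 'I_j.+1 -> 'I_j.+1})), forall a,
    let r := q.1.1 : nat in let m := q.1.2 : nat in
    let t i := q.2.1 (inord i) in let p i := q.2.2 (inord i) : nat in
    (forall i, (i < r.+1 + m)%N -> `|a i| <= j.+1%:R) ->
    let y i := x (t i) (nth 0%N h (p i)) in
    `|partial_lim r.+1 m (extend_past r y (x (t r) k)) t a - partial_lim r m.+1 y t a|
      <= 2^-1 ^+ j.+1.
  apply: filter_forall => -[[r m] [t0 p0]] /=.
  set t := fun i : nat => t0 (inord i); set p := fun i : nat => p0 (inord i) : nat.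
  set y := fun i => x (t i) (nth 0%N h (p i)).
  apply: (@cube_uniform _ _ _ _ (fun k a =>
    `|partial_lim r.+1 m (extend_past r y (x (t r) k)) t a - partial_lim r m.+1 y t a|)
     _ (2 * B)) => //.
  - by rewrite mulr_ge0.
  - move=> k a b.
    have yB i : `|y i| <= B by exact: xB.
    have y'B i : `|extend_past r y (x (t r) k) i| <= B.
      by rewrite /extend_past; case: ifP.
    have h1 := @partial_lim_lip r.+1 m _ t a b y'B.
    have h2 := @partial_lim_lip r.+1 m _ t b a y'B.
    have h3 := @partial_lim_lip r m.+1 _ t a b yB.
    have h4 := @partial_lim_lip r m.+1 _ t b a yB.
    have e1 n : \sum_(i < n) `|b i - a i| = \sum_(i < n) `|a i - b i|.
      by apply: eq_bigr => i _; rewrite distrC.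
    rewrite -addSnnS !e1 in h1 h2 h3 h4.
    set s := partial_lim r.+1 m _ t b in h1 h2 *.
    set s' := partial_lim r m.+1 _ t b in h3 h4 *.
    have := ler_norm (s - s'); have := ler_norm (- (s - s')); rewrite normrN.
    by rewrite ler_norml; lra.
  - move=> a e e0; have /cvgrPdist_le/(_ _ e0) := @partial_lim_step r m y t a.
    by apply: filterS => k; rewrite distrC.
apply: filterS => k hk r m t p a rm aA /=; set y := fun i : nat => x (t i) _.
have rj : (r < j.+1)%N by rewrite ltnS /j; lia.
have mj : (m < j.+1)%N by rewrite ltnS /j; lia.
pose pt : 'I_j.+1 -> I := fun i => t i.
pose pp : 'I_j.+1 -> 'I_j.+1 := fun i => inord (minn (p i) j).
pose f1 : {ffun 'I_j.+1 -> I} := [ffun i => pt i].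
pose f2 : {ffun 'I_j.+1 -> 'I_j.+1} := [ffun i => pp i].
pose t' i := f1 (inord i); pose y' i := x (t' i) (nth 0%N h (f2 (inord i))).
have : `|partial_lim r.+1 m (extend_past r y' (x (t' r) k)) t' a -
    partial_lim r m.+1 y' t' a| <= 2^-1 ^+ j.+1.
  exact: (hk ((Ordinal rj, Ordinal mj), (f1, f2)) a aA).
have t'E i : (i <= j)%N -> t' i = t i by move=> ij; rewrite /t' ffunE /pt inordK.
have y'E i : (i <= j)%N -> y' i = y i.
  move=> ij; rewrite /y' /y t'E // ffunE /pp !inordK //; last by rewrite ltnS geq_minr.
  by have [pj|pj] := leqP (p i) j; rewrite // !nth_default // -/j ltnW.
rewrite t'E; last by rewrite -ltnS.
rewrite (@partial_lim_ext r.+1 m _ (extend_past r y (x (t r) k)) t' t) //.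
- rewrite (@partial_lim_ext r m.+1 y' y t' t) // => i ir.
    by apply: y'E; rewrite /j; lia.
  by apply: t'E; rewrite /j; lia.
- move=> i ir; rewrite /extend_past; case: eqP => // /eqP ne.
  by apply: y'E; rewrite /j; lia.
- by move=> i ir; apply: t'E; rewrite /j; lia.
Qed.

End IteratedLimit.

Section FastAsymptoticNorm.
Context {R : realType} {X : normedModType R}.

(** Stability with a rate.  The bounds on the number of terms and on the coefficients
    grow with the first index: every single combination satisfies them eventually, and
    for [n <= l 0 + 1] they cover the whole unit cube, as the uniform estimates in the
    definition of a spreading model require. *)
Definition fast_asymptotic_norm (I : Type) (x : I -> nat -> X)
    (N : nat -> (nat -> I) -> (nat -> R) -> R) : Prop :=
  forall n (t : nat -> I) (a : nat -> R) l, sincr l -> (n <= (l 0%N).+1)%N ->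
    (forall i, (i < n)%N -> `|a i| <= (l 0%N).+1%:R) ->
    `| `|\sum_(i < n) a i *: x (t i) (l i)| - N n t a| <= 2^-1 ^+ l 0%N.

End FastAsymptoticNorm.

Section BrunelSucheston.
Context {R : realType} {X : normedModType R} {I : finType}.

(** Along a diagonal sequence for [step_set], passing from the iterated limit to the
    norm of an actual combination exchanges one limit after the other for its chosen
    index, and the errors [2 ^ - (l r).+1] sum up to at most [2 ^ - (l 0)]. *)
Theorem brunel_sucheston (x : I -> nat -> X) (B : R) :
  (forall c k, `|x c k| <= B) ->
  exists k (N : nat -> (nat -> I) -> (nat -> R) -> R),
    sincr k /\ fast_asymptotic_norm (fun c => x c \o k) N.
Proof.
move=> xB0; pose B' := Num.max 0 B.
have B'0 : 0 <= B' by rewrite le_max lexx.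
have xB c k : `|x c k| <= B' by rewrite le_max xB0 orbT.
have [U [UU Uoo]] := @ultraFilterLemma nat \oo _.
have [k [k_incr kP]] := diagonal_sequence Uoo (fun h => @step_set_near _ _ _ U UU x _ B'0 xB h).
exists k, (fun n t a => @ilim _ _ _ U x n t a 0); split=> // n t a l hl nl al.
pose y i := x (t i) (k (l i)).
have step r : (r <= n)%N ->
    `|@partial_lim _ _ _ U x r (n - r) y t a - @ilim _ _ _ U x n t a 0| <=
    2^-1 ^+ l 0%N * (1 - 2^-1 ^+ r).
  elim: r => [|r IH] rn.
    by rewrite subn0 /partial_lim big_ord0 subrr normr0 expr0 subrr mulr0.
  have lr : (l 0%N + r <= l r)%N by have := sincr_add 0 r hl; rewrite add0n.
  have szr : size (mkseq k (l r)) = l r by rewrite size_mkseq.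
  have al' i : (i < r.+1 + (n - r.+1))%N -> `|a i| <= (l r).+1%:R.
    move=> ir; apply: le_trans (al i _) _; first by lia.
    by rewrite ler_nat; lia.
  have rl : (r + (n - r.+1) <= l r)%N by lia.
  have := kP (l r) r (n - r.+1)%N t l a; rewrite szr => /(_ rl al') /=.
  have nE : ((n - r.+1).+1 = n - r)%N by lia.
  rewrite nE (@partial_lim_ext _ _ _ U x r.+1 _ _ y t t a) //; last first.
    move=> i ir; rewrite /extend_past; case: eqP => [->//|/eqP ne].
    by rewrite nth_mkseq //; apply: sincr_lt => //; lia.
  rewrite (@partial_lim_ext _ _ _ U x r _ _ y t t a) //; last first.
    by move=> i ir; rewrite nth_mkseq //; apply: sincr_lt.
  move=> h; have := IH (ltnW rn).
  have : 2^-1 ^+ (l r).+1 <= 2^-1 ^+ l 0%N * 2^-1 ^+ r.+1 :> R.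
    by rewrite -exprD; apply: ler_wiXn2l; [lra|lra|lia].
  have -> : 2^-1 ^+ l 0%N * 2^-1 ^+ r.+1 = 2^-1 ^+ l 0%N * 2^-1 ^+ r / 2 :> R.
    by rewrite exprSr mulrA.
  have -> : 2^-1 ^+ l 0%N * (1 - 2^-1 ^+ r.+1) =
     2^-1 ^+ l 0%N - 2^-1 ^+ l 0%N * 2^-1 ^+ r / 2 :> R.
    by rewrite mulrBr mulr1 exprSr mulrA.
  move: h; rewrite !ler_norml mulrBr mulr1.
  lra.
have := step n (leqnn n); rewrite subnn /partial_lim /= => h; apply: le_trans h _.
rewrite -[leRHS]mulr1 ler_wpM2l ?exprn_ge0 ?invr_ge0 //.
Qed.

Lemma fast_asymptotic (x : I -> nat -> X) N :
  fast_asymptotic_norm x N -> asymptotic_norm x N.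
Proof.
move=> fast n t a; apply/cvgrPdist_le => e e0.
have : 2^-1 ^+ m @[m --> \oo] --> (0 : R).
  by apply: cvg_expr; rewrite ger0_norm ?invr_ge0 // invf_lt1 // ltr1n.
move/cvgrPdist_le => /(_ _ e0)[m _ /(_ m (leqnn m))].
rewrite sub0r normrN ger0_norm ?exprn_ge0 ?invr_ge0 // => em.
pose A := Num.truncn (\sum_(i < n) `|a i|).
apply: (near_spreadP (K := maxn m (maxn n A))) => l hl.
rewrite !geq_max => /andP[ml /andP[nl Al]].
rewrite distrC; apply: le_trans (fast _ _ _ _ hl _ _) (le_trans _ em).
- exact: leqW.
- move=> i i_n; apply: le_trans (_ : \sum_(i < n) `|a i| <= _).
    by rewrite (bigD1 (Ordinal i_n)) //= lerDl sumr_ge0.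
  apply: ltW; apply: lt_le_trans (truncnS_gt _) _.
  by rewrite ler_nat ltnS.
- by apply: ler_wiXn2l; [lra|lra|].
Qed.

End BrunelSucheston.

Section BasicSubsequence.
Context {R : realType} {X : normedModType R}.

Definition basis_constant (K : R) (s : nat -> X) : Prop :=
  forall n m (a : nat -> R), (n <= m)%N ->
    `|\sum_(i < n) a i *: s i| <= K * `|\sum_(i < m) a i *: s i|.

(** Choose the next index so late that a norming functional of each earlier
    combination nearly annihilates the new term.  The resulting inequalities hold up to
    additive errors of total size 1/4, for coefficients in the unit cube.  When the
    largest coefficient is 1, two consecutive partial sums differ by a vector of norm
    1, so one of them has norm at least 1/2 and the whole sum at least 1/4: the additive
    error is absorbed into the constant 2. *)
Theorem basic_subsequence (s : nat -> X) : normalized s -> weakly_null s ->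
  exists k, sincr k /\ basis_constant 2 (s \o k).
Proof.
move=> s1 s_wn.
pose v h (a : nat -> R) := \sum_(i < size h) a i *: s (nth 0%N h i).
pose C (h : seq nat) : set nat := [set k | forall a,
  (forall i, (i < (size h).+1)%N -> `|a i| <= 1) ->
  `|v h a| - `|v h a + a (size h) *: s k| <= 2^-1 ^+ (size h).+3].
have FC h : \oo (C h).
  have : 0 < 2^-1 ^+ (size h).+3 :> R by rewrite exprn_gt0 // invr_gt0.
  apply: (@cube_uniform R nat \oo _
    (fun k a => `|v h a| - `|v h a + a (size h) *: s k|) (size h).+1 2 1) => //.
  - move=> k a b.
    have e1 : `|v h a - v h b| <= \sum_(i < size h) `|a i - b i|.
      rewrite /v -sumrB; apply: le_trans (ler_norm_sum _ _ _) _.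
      by apply: ler_sum => i _; rewrite -scalerBl normrZ s1 mulr1.
    have := lerB_dist (v h a) (v h b).
    have := lerB_dist (v h b + b (size h) *: s k) (v h a + a (size h) *: s k).
    have := ler_normD (v h b - v h a) ((b (size h) - a (size h)) *: s k).
    rewrite normrZ s1 mulr1 (distrC (v h b)) (distrC (b _)) scalerBl addrACA -opprD.
    rewrite big_ord_recr /= mulrDr.
    set u1 := `|v h a - v h b| in e1 *; set u2 := `|a _ - b _|.
    set u3 := \sum_(i < _) _ in e1 *.
    have : 0 <= u3 by apply: sumr_ge0.
    have : 0 <= u2 by exact: normr_ge0.
    lra.
  - move=> a e e0; have [f [fc fn fv]] := norming_functional (v h a).
    have A0 : 0 < `|a (size h)| + 1 by rewrite ltr_wpDl.
    have /cvgrPdist_le/(_ (e / (`|a (size h)| + 1))) := s_wn f fc.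
    case=> [|m _ hm]; first by rewrite divr_gt0.
    exists m => // k /hm; rewrite /= sub0r normrN ler_pdivlMr // => hk.
    rewrite -fv -[in X in f X](addrK (a (size h) *: s k) (v h a)) linearB linearZ /=.
    have h1 := le_trans (ler_norm _) (fn (v h a + a (size h) *: s k)).
    have h2 : - (a (size h) * f (s k)) <= e.
      apply: le_trans (ler_norm _) _; rewrite normrN normrM mulrC; apply: le_trans hk.
      by rewrite ler_wpM2l // lerDl.
    move: h1 h2; rewrite /GRing.scale /=; lra.
have [k [k_incr kC]] := diagonal_sequence (fun A => id) FC.
exists k; split=> // n m a nm.
pose S (b : nat -> R) j := \sum_(i < j) b i *: s (k i).
have step b j : (forall i, (i < m)%N -> `|b i| <= 1) -> (j < m)%N ->
    `|S b j| <= `|S b j.+1| + 2^-1 ^+ j.+3.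
  move=> b1 jm; have := kC j b; rewrite size_mkseq.
  have -> : v (mkseq k j) b = S b j.
    by rewrite /v /S size_mkseq; apply: eq_bigr => i _; rewrite nth_mkseq.
  have bj i : (i < j.+1)%N -> `|b i| <= 1 by move=> ij; apply: b1; lia.
  move=> /(_ bj).
  have -> : S b j.+1 = S b j + b j *: s (k j) by rewrite /S big_ord_recr.
  lra.
have tail b j d : (forall i, (i < m)%N -> `|b i| <= 1) -> (j + d <= m)%N ->
    `|S b j| <= `|S b (j + d)%N| + 4^-1 * (1 - 2^-1 ^+ d).
  move=> b1; elim: d => [|d IH] jd; first by rewrite addn0 expr0 subrr mulr0 addr0.
  have := IH _; rewrite addnS in jd *; move=> /(_ (ltnW jd)).
  have := step b _ b1 jd.
  have : 2^-1 ^+ (j + d).+3 <= 4^-1 * 2^-1 ^+ d.+1 :> R.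
    have -> : 4^-1 = 2^-1 ^+ 2 :> R by rewrite expr2; lra.
    by rewrite -exprD; apply: ler_wiXn2l; [lra|lra|lia].
  have -> : 4^-1 * 2^-1 ^+ d.+1 = 4^-1 * 2^-1 ^+ d / 2 :> R by rewrite exprSr mulrA.
  have -> : 4^-1 * (1 - 2^-1 ^+ d.+1) = 4^-1 - 4^-1 * 2^-1 ^+ d / 2 :> R.
    by rewrite mulrBr mulr1 exprSr mulrA.
  rewrite mulrBr mulr1; lra.
have tail' b j : (forall i, (i < m)%N -> `|b i| <= 1) -> (j <= m)%N ->
    `|S b j| <= `|S b m| + 4^-1.
  move=> b1 jm; have := tail b j (m - j)%N b1; rewrite subnKC // => /(_ (leqnn _)) h.
  apply: le_trans h _; rewrite lerD2l mulrBr mulr1 lerBlDr lerDl mulr_ge0 //.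
case: m => [|m] in nm S step tail tail' *.
  by move: nm; rewrite leqn0 => /eqP ->; rewrite !big_ord0 normr0 mulr0.
(* Scale by the largest coefficient, whose index is [i0]. *)
pose i0 := [arg max_(i > (ord0 : 'I_m.+1)) `|a i|]%O.
have i0P j : (j < m.+1)%N -> `|a j| <= `|a i0|.
  move=> jm; rewrite /i0; case: arg_maxP => // i _ /(_ (Ordinal jm) isT); exact.
have [ai0|ai0] := eqVneq (a i0) 0.
  rewrite big1 ?normr0; last first.
    move=> i _; have := i0P i (leq_trans (ltn_ord i) nm).
    by rewrite ai0 normr0 normr_le0 => /eqP ->; rewrite scale0r.
  by rewrite mulr_ge0.
have ap : 0 < `|a i0| by rewrite normr_gt0.
pose b i := a i / `|a i0|.
have b1 i : (i < m.+1)%N -> `|b i| <= 1.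
  by move=> im; rewrite /b normrM normfV normr_id ler_pdivrMr // mul1r i0P.
have bS j : S a j = `|a i0| *: S b j.
  rewrite /S scaler_sumr; apply: eq_bigr => i _.
  by rewrite scalerA /b mulrC divfK // normr_eq0.
have Sm : 4^-1 <= `|S b m.+1|.
  have h1 := tail' b i0 b1 (ltnW (ltn_ord _)).
  have h2 := tail' b i0.+1 b1 (ltn_ord _).
  have h3 : S b i0.+1 - S b i0 = b i0 *: s (k i0).
    by rewrite /S big_ord_recr /= addrAC subrr add0r.
  have h4 : `|b i0 *: s (k i0)| = 1.
    by rewrite normrZ s1 mulr1 /b normrM normfV normr_id divff // normr_eq0.
  have := ler_normB (S b i0.+1) (S b i0); rewrite h3 h4; lra.
rewrite -/(S a n) -/(S a m.+1) !bS !normrZ normr_id mulrCA ler_wpM2l //.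
have := tail' b n b1 nm; lra.
Qed.

End BasicSubsequence.

(** * A Banach space for a monotone family of seminorms *)

(** The norms [pnorm n] of initial segments of a monotone basis.  The lower bound
    [pnorm_lb] on coordinates makes the coordinate functionals continuous. *)
Record mono_seminorm (R : realType) := MonoSeminorm {
  pnorm : nat -> (nat -> R) -> R;
  pnorm_lb : R;
  pnorm_lb_gt0 : 0 < pnorm_lb;
  pnormD : forall n a b, pnorm n (fun i => a i + b i) <= pnorm n a + pnorm n b;
  pnormZ : forall n c a, pnorm n (fun i => c * a i) = `|c| * pnorm n a;
  pnorm_mono : forall n m a, (n <= m)%N -> pnorm n a <= pnorm m a;
  pnorm_pad : forall n m a, (n <= m)%N ->
    pnorm m (fun i => if (i < n)%N then a i else 0) = pnorm n a;
  pnorm_ext : forall n a b, (forall i, (i < n)%N -> a i = b i) -> pnorm n a = pnorm n b;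
  pnorm_coord : forall n a i, (i < n)%N -> pnorm_lb * `|a i| <= pnorm n a }.

Section SequenceSpace.
Context {R : realType} (s : mono_seminorm R).
Local Notation N := (pnorm s).

Definition finite_norm : pred (nat -> R^o) := fun a => `[< exists M, forall n, N n a <= M >].

Lemma pnorm0 n : N n (fun=> 0) = 0.
Proof.
rewrite (@pnorm_ext _ s n _ (fun=> 0 * 0)); last by move=> i _; rewrite mul0r.
by rewrite (pnormZ s n 0 (fun=> 0)) normr0 mul0r.
Qed.

Lemma pnorm_ge0 n a : 0 <= N n a.
Proof.
have := pnorm_mono s a (leq0n n); apply: le_trans.
by rewrite (@pnorm_ext _ s 0 a (fun=> 0)) ?pnorm0.
Qed.

Lemma finite_norm_submod : submod_closed finite_norm.
Proof.
split=> [|c a b /asboolP[M aM] /asboolP[M' bM']].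
  by apply/asboolP; exists 0 => n; rewrite (_ : 0 = fun=> 0) // pnorm0.
apply/asboolP; exists (`|c| * M + M') => n.
apply: le_trans (_ : N n (fun i => c * a i) + N n b <= _); first exact: pnormD.
by rewrite pnormZ; apply: lerD => //; exact: ler_wpM2l.
Qed.

HB.instance Definition _ := GRing.isSubmodClosed.Build R (nat -> R^o) finite_norm
  finite_norm_submod.

Record seqspace := SeqSpace { seqval :> nat -> R^o; _ : seqval \in finite_norm }.
HB.instance Definition _ := [isSub for seqval].
HB.instance Definition _ := [Choice of seqspace by <:].
HB.instance Definition _ := [SubChoice_isSubZmodule of seqspace by <:].
HB.instance Definition _ := [SubZmodule_isSubLmodule of seqspace by <:].

Definition seqnorm (a : seqspace) : R := sup (range (fun n => N n a)).

Lemma seqnorm_has_sup (a : seqspace) : has_sup (range (fun n => N n a)).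
Proof.
split; first by exists (N 0 a), 0%N.
by case: a => a /= /asboolP[M aM]; exists M => _ [n _ <-].
Qed.

Lemma pnorm_le_seqnorm n (a : seqspace) : N n a <= seqnorm a.
Proof. by apply: ub_le_sup; [case: (seqnorm_has_sup a) | exists n]. Qed.

Lemma seqnorm_le (a : seqspace) M : (forall n, N n a <= M) -> seqnorm a <= M.
Proof.
move=> h; apply: ge_sup; first by case: (seqnorm_has_sup a).
by move=> _ [n _ <-].
Qed.

Lemma seqnormD (a b : seqspace) : seqnorm (a + b) <= seqnorm a + seqnorm b.
Proof.
apply: seqnorm_le => n; apply: le_trans (pnormD s n a b) _.
by apply: lerD; exact: pnorm_le_seqnorm.
Qed.

Lemma seqnormZ (c : R) (a : seqspace) : seqnorm (c *: a) = `|c| * seqnorm a.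
Proof.
have le1 (d : R) (b : seqspace) : seqnorm (d *: b) <= `|d| * seqnorm b.
  apply: seqnorm_le => n; rewrite (pnormZ s n d b : N n (d *: b) = _).
  by rewrite ler_wpM2l // pnorm_le_seqnorm.
apply/eqP; rewrite eq_le le1 /=; have [->|c0] := eqVneq c 0.
  rewrite normr0 mul0r; exact: le_trans (pnorm_ge0 0 _) (pnorm_le_seqnorm 0 _).
have := le1 c^-1 (c *: a); rewrite scalerA mulVf // scale1r.
by rewrite normfV ler_pdivlMl // normr_gt0.
Qed.

Lemma seqnorm0_eq0 (a : seqspace) : seqnorm a = 0 -> a = 0.
Proof.
move=> a0; apply/val_inj/funext => i /=.
have := le_trans (pnorm_coord s a (ltnSn i)) (pnorm_le_seqnorm i.+1 a).
by rewrite a0 pmulr_rle0 ?pnorm_lb_gt0 // normr_le0 => /eqP.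
Qed.

HB.instance Definition _ := Lmodule_isNormed.Build R seqspace
  seqnormD seqnormZ seqnorm0_eq0.

Lemma pnorm_continuous n (F : set_system seqspace) {FF : ProperFilter F} (b : nat -> R) :
  (forall i, (fun a : seqspace => a i : R) @ F --> b i) ->
  forall e, 0 < e -> \forall a \near F, N n (fun i => seqval a i - b i) <= e.
Proof.
move=> Fb.
pose C := \sum_(i < n) N n (fun j => (j == i)%:R).
have C0 : 0 <= C by apply: sumr_ge0 => i _; exact: pnorm_ge0.
have le_max (c : nat -> R) d : 0 <= d -> (forall i, (i < n)%N -> `|c i| <= d) -> N n c <= d * C.
  move=> d0 cd; have h m : (m <= n)%N ->
      N n (fun j => if (j < m)%N then c j else 0) <= d * \sum_(i < m) N n (fun j => (j == i)%:R).
    elim: m => [|m IH] mn; first by rewrite big_ord0 mulr0 pnorm0.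
    rewrite big_ord_recr /= mulrDr; apply: le_trans (lerD (IH (ltnW mn)) (lexx _)).
    apply: le_trans (_ : N n (fun j => if (j < m)%N then c j else 0) +
       N n (fun j => c m * (j == m)%:R) <= _).
      apply: le_trans (pnormD s n _ _); rewrite le_eqVlt; apply/orP; left; apply/eqP.
      apply: pnorm_ext => i _; rewrite ltnS leq_eqVlt.
      by case: ltngtP => //= [||->]; rewrite ?mulr0 ?addr0 ?mulr1 ?add0r.
    by rewrite lerD2l pnormZ ler_wpM2r ?pnorm_ge0 // cd.
  by apply: le_trans (h n (leqnn n));
  rewrite (@pnorm_ext _ s n c (fun j => if (j < n)%N then c j else 0)) // => i ->.
move=> e e0; have C1 : 0 < C + 1 by rewrite ltr_wpDl.
have : \forall a \near F, forall i : 'I_n, `|(a : seqspace) i - b i| <= e / (C + 1).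
  apply: filter_forall => i; have /cvgrPdist_le/(_ (e / (C + 1))) := Fb i.
  by rewrite divr_gt0 // => /(_ isT); apply: filterS => a; rewrite distrC.
apply: filterS => a ha; apply: le_trans (le_max _ (e / (C + 1)) _ _) _.
- by rewrite divr_ge0 // ltW.
- by move=> i i_n; exact: (ha (Ordinal i_n)).
by rewrite mulrAC ler_pdivrMr // ler_wpM2l ?ltW // ltrDl.
Qed.

(** A Cauchy filter converges coordinatewise; for each [n] the seminorm [pnorm n] is
    continuous for coordinatewise convergence, so the Cauchy bounds pass to the
    limit with the same constant for all [n]. *)
Lemma seqspace_complete (F : set_system seqspace) : ProperFilter F -> cauchy F -> cvg F.
Proof.
move=> FF /cauchyP Fc.
have Fcauchy e : 0 < e -> exists2 A : set seqspace, F A &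
    forall a a', A a -> A a' -> `|a - a'| <= e.
  move=> e0; have [a Fa] := Fc (e / 2) (divr_gt0 e0 (ltr0Sn _ _)).
  exists (ball a (e / 2)) => // u v; rewrite -ball_normE /= => h1 h2.
  rewrite -(subrKA a) (splitr e); apply: le_trans (ler_normD _ _) _.
  by apply: lerD; [rewrite distrC|]; exact: ltW.
have coord (a a' : seqspace) i : `|a i - a' i| <= `|a - a'| / pnorm_lb s.
  rewrite ler_pdivlMr ?pnorm_lb_gt0 // mulrC.
  exact: le_trans (pnorm_coord s (a - a') (ltnSn i)) (pnorm_le_seqnorm i.+1 (a - a')).
have Fi i : cvg ((fun a : seqspace => a i : R^o) @ F).
  apply: cauchy_cvg; apply: cauchy_exP => e e0.
  have [A FA hA] := Fcauchy (e / 2 * pnorm_lb s) (mulr_gt0 (divr_gt0 e0 (ltr0Sn _ _)) (pnorm_lb_gt0 s)).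
  have [a0 Aa0] := filter_ex FA; exists (a0 i).
  suff : F [set a : seqspace | ball (a0 i : R^o) e (a i)] by [].
  apply: filterS FA => a Aa.
  rewrite /= -ball_normE /=; apply: le_lt_trans (coord a0 a i) _.
  rewrite ltr_pdivrMr ?pnorm_lb_gt0 //; apply: le_lt_trans (hA _ _ Aa0 Aa) _.
  by rewrite ltr_pM2r ?pnorm_lb_gt0 //; lra.
pose b i : R := lim ((fun a : seqspace => a i : R^o) @ F).
have close e : 0 < e -> \forall a \near F, forall n, N n (fun i => (a : seqspace) i - b i) <= e.
  move=> e0; have [A FA hA] := Fcauchy (e / 2) (divr_gt0 e0 (ltr0Sn _ _)).
  apply: filterS (FA) => a Aa n.
  have [a' [Aa' ha']] := filter_ex (filterI FA
    (@pnorm_continuous n F FF b Fi _ (divr_gt0 e0 (ltr0Sn _ 1)))).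
  rewrite (splitr e); apply: le_trans (_ : N n (a - a') + N n (fun i => a' i - b i) <= _).
    apply: le_trans (pnormD s n _ _); rewrite le_eqVlt; apply/orP; left; apply/eqP.
    by apply: pnorm_ext => i _ /=; rewrite subrKA.
  by apply: lerD => //; apply: le_trans (pnorm_le_seqnorm _ _) (hA _ _ Aa Aa').
have [a1 a1P] := filter_ex (close 1 ltr01).
have bP : (b : nat -> R^o) \in finite_norm.
  apply/asboolP; exists (seqnorm a1 + 1) => n.
  apply: le_trans (_ : N n a1 + N n (fun i => -1 * (a1 i - b i)) <= _).
    apply: le_trans (pnormD s n _ _); rewrite le_eqVlt; apply/orP; left; apply/eqP.
    by apply: pnorm_ext => i _ /=; ring.
  by rewrite pnormZ normrN normr1 mul1r lerD // pnorm_le_seqnorm.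
apply/cvg_ex; exists (SeqSpace bP); apply/cvgrPdist_le => e e0.
apply: filterS (close e e0) => a ha; rewrite distrC.
exact: seqnorm_le.
Qed.

HB.instance Definition _ := Uniform_isComplete.Build seqspace seqspace_complete.

Lemma unit_vector_subproof (i : nat) :
  ((fun j => (j == i)%:R) : nat -> R^o) \in finite_norm.
Proof.
apply/asboolP; exists (N i.+1 (fun j => (j == i)%:R)) => n.
rewrite -[leRHS](pnorm_pad s _ (leq_maxr n i.+1)).
apply: le_trans (pnorm_mono s _ (leq_maxl n i.+1)) _.
rewrite le_eqVlt; apply/orP; left; apply/eqP; apply: pnorm_ext => j _.
by case: ltnP => // ij; rewrite gtn_eqF.
Qed.

Definition unit_vector i : seqspace := SeqSpace (unit_vector_subproof i).

(** The space contains the finitely supported sequences isometrically, because the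
    seminorms of a sequence supported in [0, n) stay constant from [n] on. *)
Lemma norm_unit_comb n (a : nat -> R) : `|\sum_(i < n) a i *: unit_vector i| = N n a.
Proof.
have valE : seqval (\sum_(i < n) a i *: unit_vector i) =
    (fun j => if (j < n)%N then a j else 0).
  apply/funext => j; elim: n => [|n IH]; first by rewrite big_ord0.
  rewrite big_ord_recr; transitivity (seqval (\sum_(i < n) a i *: unit_vector i) j
      + a n * (j == n)%:R) => //.
  rewrite IH.
  by rewrite ltnS; case: (ltngtP j n) => [jn|jn|->] /=;
    rewrite ?mulr0 ?addr0 ?mulr1 ?add0r.
apply/eqP; rewrite eq_le; apply/andP; split.
  apply: seqnorm_le => m; rewrite valE.
  rewrite -[leRHS](pnorm_pad s _ (leq_maxr m n)).
  exact: pnorm_mono (leq_maxl m n).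
rewrite -[leLHS](pnorm_pad s _ (leqnn n)) -valE; exact: pnorm_le_seqnorm.
Qed.

End SequenceSpace.

Section BasicCriterion.
Context {R : realType} {E : normedModType R}.

Lemma cvg_comb (e : nat -> E) n (b : nat -> nat -> R) (a : nat -> R) :
  (forall i, (fun k => b k i) @ \oo --> a i) ->
  (fun k => \sum_(i < n) b k i *: e i) @ \oo --> \sum_(i < n) a i *: e i.
Proof.
move=> ba; elim: n => [|n IH].
  rewrite big_ord0 (_ : (fun _ => _) = fun=> 0); first exact: cvg_cst.
  by apply/funext => k; rewrite big_ord0.
rewrite big_ord_recr /= (_ : (fun _ => _) =
  (fun k => \sum_(i < n) b k i *: e i + b k n *: e n)); last first.
  by apply/funext => k; rewrite big_ord_recr.
by apply: cvgD => //; apply: cvgZr_tmp.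
Qed.

(** Approximate [v] by combinations [u k].  The basis constant bounds the coordinates
    of [u k - u l] by its norm, so that coordinates converge; it also bounds the
    partial sums of [u k - u l], and letting [l] tend to infinity shows that the
    series of limit coordinates stays close to [u k]. *)
Theorem basis_constant_basic (e : nat -> E) (K c : R) : basis_constant K e ->
  0 < c -> (forall i, c <= `|e i|) -> basic_sequence e.
Proof.
move=> eK c0 ec v v_cl.
have coord n m (a : nat -> R) i : (i < m)%N -> (m <= n)%N ->
    c * `|a i| <= 2 * (K * `|\sum_(i < n) a i *: e i|).
  move=> im mn; have h1 := eK _ _ a (leq_trans im mn).
  have h2 := eK _ _ a (ltnW (leq_trans im mn)).
  have := ler_normB (\sum_(j < i.+1) a j *: e j) (\sum_(j < i) a j *: e j).
  rewrite {1}big_ord_recr /= addrAC subrr add0r normrZ.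
  have := ler_wpM2l (normr_ge0 (a i)) (ec i); rewrite mulrC; lra.
have approx k : exists p : nat * (nat -> R),
    (forall i, (p.1 <= i)%N -> p.2 i = 0) /\ `|v - \sum_(i < p.1) p.2 i *: e i| < k.+1%:R^-1.
  have [|u [[n [a ->]]]] := v_cl (ball v k.+1%:R^-1).
    by apply: nbhsx_ballx; rewrite invr_gt0.
  rewrite -ball_normE /= => h; exists (n, extend a); split=> /=.
    by move=> i ni; rewrite /extend insubF // ltnNge ni.
  by under eq_bigr do rewrite extendE.
have [p pP] := choice approx.
pose N k := (p k).1; pose a k := (p k).2.
pose eps k : R := k.+1%:R^-1.
pose u k := \sum_(i < N k) a k i *: e i.
have uE k n : (N k <= n)%N -> u k = \sum_(i < n) a k i *: e i.
  move=> Nn; rewrite /u (big_ord_widen _ (fun i => a k i *: e i) Nn) big_mkcond /=.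
  apply: eq_bigr => i _; case: ltnP => // Ni.
  by rewrite /a (pP k).1 // scale0r.
have uv k : `|v - u k| <= eps k by apply: ltW; have := (pP k).2.
have K0 : 0 <= K.
  have := eK 1%N 1%N (fun=> 1) (leqnn _); rewrite big_ord1 scale1r => h.
  have e0 : 0 < `|e 0%N| by apply: lt_le_trans (ec 0%N).
  by move: h; rewrite ler_pMl //; lra.
have diff k l n : `|\sum_(i < n) (a k i - a l i) *: e i| <= K * (eps k + eps l).
  pose m := maxn n (maxn (N k) (N l)).
  apply: le_trans (eK n m (fun i => a k i - a l i) (leq_maxl _ _)) _.
  rewrite ler_wpM2l //.
  have -> : \sum_(i < m) (a k i - a l i) *: e i = u k - u l.
    rewrite (uE k m) ?(uE l m) /m; try by lia.
    by rewrite -sumrB; apply: eq_bigr => i _; rewrite scalerBl.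
  rewrite -(subrKA v); apply: le_trans (ler_normD _ _) _.
  by apply: lerD => //; rewrite distrC.
have eps_small d : 0 < d -> exists k0, forall k, (k0 <= k)%N -> eps k <= d.
  move=> d0; exists (Num.truncn d^-1) => k hk.
  rewrite /eps -[leRHS]invrK lef_pV2 ?posrE ?invr_gt0 //.
  by apply: ltW; apply: lt_le_trans (truncnS_gt _) _; rewrite ler_nat ltnS.
have dc_gt0 d : 0 < d -> 0 < d * c / 2 / (4 * (K * K) + 1).
  by move=> d0; rewrite !divr_gt0 ?mulr_gt0 // ltr_wpDl // !mulr_ge0.
have a_cauchy d : 0 < d -> exists k0, forall k, (k0 <= k)%N ->
    forall i, `|a k0 i - a k i| < d.
  move=> d0; have [k0 hk0] := eps_small _ (dc_gt0 d d0).
  exists k0 => k k0k i.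
  have h := coord i.+1 i.+1 (fun j => a k0 j - a k j) i (ltnSn _) (leqnn _).
  have M0 : 0 < 4 * (K * K) + 1 by rewrite ltr_wpDl // !mulr_ge0.
  have := lerD (hk0 _ (leqnn k0)) (hk0 _ k0k).
  set D := d * c / 2 / _ => h2.
  have DM : D * (4 * (K * K) + 1) = d * c / 2 by rewrite /D divfK // gt_eqF.
  have D0 : 0 < D := dc_gt0 d d0.
  have h3 := le_trans (diff k0 k i.+1) (ler_wpM2l K0 h2).
  rewrite -(ltr_pM2l c0) (mulrC c d); apply: le_lt_trans h _.
  apply: le_lt_trans (_ : 2 * (K * (K * (D + D))) < _).
    by rewrite ler_pM2l // ler_wpM2l.
  have -> : 2 * (K * (K * (D + D))) = d * c / 2 - D by rewrite -DM; ring.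
  have := mulr_gt0 d0 c0; lra.
have a_cvg i : cvg ((fun k => a k i : R^o) @ \oo).
  apply: cauchy_cvg; apply: cauchy_exP => d d0; have [k0 hk0] := a_cauchy d d0.
  exists (a k0 i); exists k0 => // k /= k0k; rewrite -ball_normE /=.
  exact: hk0.
pose b i : R := lim ((fun k => a k i : R^o) @ \oo).
have close k n : `|\sum_(i < n) (b i - a k i) *: e i| <= K * (2 * eps k).
  have : (fun l => `|\sum_(i < n) (a l i - a k i) *: e i|) @ \oo -->
      `|\sum_(i < n) (b i - a k i) *: e i|.
    apply: cvg_norm; apply: (@cvg_comb e n (fun l i => a l i - a k i) (fun i => b i - a k i)) => i.
    by apply: cvgB; [exact: a_cvg | exact: cvg_cst].
  move=> /le_lim; apply; [exact: cvg_cst|].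
  have eps0 : 0 < eps k by rewrite invr_gt0.
  have [k0 hk0] := eps_small _ eps0.
  exists k0 => // l /= /hk0 lk; apply: le_trans (diff l k n) _.
  by rewrite ler_wpM2l //; lra.
have b_series : series (fun i => b i *: e i) @ \oo --> v.
  apply/cvgrPdist_le => d d0; have M0 : 0 < 2 * K + 1 by lra.
  have [k hk] := eps_small (d / (2 * K + 1)) (divr_gt0 d0 M0).
  have ek := hk k (leqnn k); exists (N k) => // n /= Nn.
  rewrite /series /= big_mkord distrC -(subrKA (u k)).
  apply: le_trans (ler_normD _ _) _.
  have -> : \sum_(i < n) b i *: e i - u k = \sum_(i < n) (b i - a k i) *: e i.
    by rewrite (uE k n) // -sumrB; apply: eq_bigr => i _; rewrite scalerBl.
  move: ek; rewrite ler_pdivlMr // => ek.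
  by have := close k n; have := uv k; rewrite distrC; lra.
exists b; split=> // b' b'_series; apply/funext => i.
have d_series : (fun n => `|\sum_(j < n) (b j - b' j) *: e j|) @ \oo --> `|v - v|.
  suff h : (fun n => \sum_(j < n) (b j - b' j) *: e j) @ \oo --> v - v by exact: cvg_norm h.
  suff -> : (fun n => \sum_(j < n) (b j - b' j) *: e j) =
    series (fun i => b i *: e i) \- series (fun i => b' i *: e i) by exact: cvgB.
  apply/funext => n; rewrite /series /= !big_mkord -sumrB.
  by apply: eq_bigr => j _; rewrite scalerBl.
rewrite subrr normr0 in d_series.
have : c * `|b i - b' i| <= 0.
  rewrite -(mulr0 2) -(mulr0 K).
  apply: (le_lim (cvg_cst _) (cvgM (cvg_cst (2 : R)) (cvgM (cvg_cst K) d_series))).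
  by exists i.+1 => // n /= i_n; apply: (coord n i.+1 (fun j => b j - b' j)).
by rewrite pmulr_rle0 // normr_le0 subr_eq0 => /eqP.
Qed.

End BasicCriterion.

(** * Spreading models from stable sequences *)

Section Realization.
Context {R : realType} {X : normedModType R}.

Lemma extend_increasing m (k : 'I_m.+1 -> nat) :
  (forall i j : 'I_m.+1, (i < j)%N -> (k i < k j)%N) ->
  exists l, sincr l /\ forall i : 'I_m.+1, l i = k i.
Proof.
move=> k_incr; exists (fun i => (k (inord (minn i m)) + (i - m))%N); split=> [i|i] /=.
  have [im|mi] := ltnP i m.
    rewrite (minn_idPl im) (eqP im) (eqP (ltnW im)) !addn0.
    by apply: k_incr; rewrite !inordK //; lia.
  by rewrite (minn_idPr (leqW mi)); lia.
have im : (i <= m)%N by rewrite -ltnS.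
by rewrite (minn_idPl im) inord_val (eqP im) addn0.
Qed.

(** Suppress all terms but one. *)
Lemma asym_ge_coord (y : nat -> X) N (c : R) : weakly_null y ->
  asymptotic_norm (fun _ : unit => y) N -> 0 <= c -> (forall n, c <= `|y n|) ->
  forall n t (a : nat -> R) i, (i < n)%N -> c * `|a i| <= N n t a.
Proof.
move=> y_wn yN c0 yc n t a i i_n.
apply: le_trans (asym_suppress yN (fun=> y_wn) n t a (pred1 i)).
apply: (le_lim (cvg_cst _) (yN n t _)); apply: nearW => l /=.
rewrite (bigD1 (Ordinal i_n)) //= eqxx big1 ?addr0.
  by rewrite normrZ mulrC ler_wpM2l.
by move=> j; rewrite -val_eqE /= => /negPf ->; rewrite scale0r.
Qed.

(** The limit norms of initial segments form a [mono_seminorm] by suppression; the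
    unit vectors of the resulting space are the spreading model, and the rate of
    [fast_asymptotic_norm] is the sequence of errors in its definition. *)
Theorem spreading_model_exists (y : nat -> X) (N : nat -> (nat -> unit) -> (nat -> R) -> R)
    (c C : R) : weakly_null y -> 0 < c -> (forall n, c <= `|y n| <= C) ->
  fast_asymptotic_norm (fun _ : unit => y) N ->
  exists (F : completeNormedModType R) (f : nat -> F), spreading_model y f /\
    forall n (a : nat -> R), `|\sum_(i < n) a i *: f i| = N n single a.
Proof.
move=> y_wn c0 yc fast.
have yN := fast_asymptotic fast.
have wn (u : unit) : weakly_null y by [].
have yc' i : c <= `|y i| by case/andP: (yc i).
have coord n a i : (i < n)%N -> c * `|a i| <= N n single a.
  exact: asym_ge_coord y_wn yN (ltW c0) yc' n single a i.
pose s := @MonoSeminorm R (fun n a => N n single a) c c0 (fun n a b => asymD yN n single a b)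
  (fun n d a => asymZ yN n single d a) (fun n m a => asym_mono yN wn single a (n := n) (m := m))
  (fun n m a nm => esym (asym_pad yN single a nm))
  (fun n a b h => asym_ext yN (fun i i_n => conj erefl (h i i_n))) coord.
have normE n (a : nat -> R) : `|\sum_(i < n) a i *: (unit_vector s i : seqspace s)| = N n single a.
  exact: norm_unit_comb.
exists (seqspace s : completeNormedModType R), (unit_vector s); split=> //.
split; first by exists c, C.
split.
  apply: (@basis_constant_basic _ _ _ 1 c) => // [n m a nm|i].
    by rewrite mul1r !normE; exact: (asym_mono yN wn).
  have -> : unit_vector s i = \sum_(j < i.+1) (j == i :> nat)%:R *: unit_vector s j.
    rewrite big_ord_recr /= eqxx scale1r big1 ?add0r // => j _.
    by rewrite ltn_eqF // scale0r.
  rewrite (normE i.+1 (fun j => (j == i)%:R)).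
  by have := coord i.+1 (fun j => (j == i)%:R) i (ltnSn i); rewrite eqxx normr1 mulr1.
exists (fun n => 4 * 2^-1 ^+ n); split; [|split].
- by move=> m n mn; rewrite ler_pM2l //; apply: ler_wiXn2l; [lra|lra|].
- rewrite -(mulr0 4); apply: cvgM; first exact: cvg_cst.
  by apply: cvg_expr; rewrite ger0_norm ?invr_ge0 // invf_lt1 // ltr1n.
case=> [//|m] _ a k a1 k_incr k_ge.
have [l [hl lk]] := extend_increasing k_incr.
have l0 : (m <= l 0)%N by have := k_ge ord0; rewrite -lk ltnS.
have -> : \sum_(i < m.+1) a i *: y (k i) = \sum_(i < m.+1) extend a i *: y (l i).
  by apply: eq_bigr => i _; rewrite extendE lk.
have -> : \sum_(i < m.+1) a i *: unit_vector s i = \sum_(i < m.+1) extend a i *: unit_vector s i.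
  by apply: eq_bigr => i _; rewrite extendE.
rewrite normE; apply: le_lt_trans (fast _ single _ _ hl _ _) _; first by rewrite ltnS.
  move=> i im; rewrite (extendE a (Ordinal im)); apply: le_trans (_ : 1 <= _).
    by rewrite ler_norml.
  by rewrite ler1n.
apply: le_lt_trans (_ : 2^-1 ^+ m < _); first by apply: ler_wiXn2l; [lra|lra|].
have : 0 < 2^-1 ^+ m :> R by rewrite exprn_gt0 // invr_gt0.
by rewrite exprS; lra.
Qed.

End Realization.

Section WeaklyNull.
Context {R : realType} {X : normedModType R}.

Lemma weakly_null_subseq (x : nat -> X) k : sincr k -> weakly_null x -> weakly_null (x \o k).
Proof.
move=> hk x_wn f fc.
have : (f \o x) \o k @ \oo --> (0 : R^o).
  apply: cvg_comp (x_wn f fc) => A [m _ mA]; exists m => // n /= mn.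
  by apply: mA => /=; apply: leq_trans mn (sincr_ge n hk).
exact.
Qed.

Lemma asymptotic_subseq (I : Type) (x : I -> nat -> X) N k : sincr k ->
  asymptotic_norm x N -> asymptotic_norm (fun c => x c \o k) N.
Proof. by move=> hk xN n t a; exact: (@asym_comp R X I x N xN n t a _ (spread_comp hk)). Qed.

(** Combinations of a subsequence are combinations of the sequence with zeros
    inserted; [b] is the inflated coefficient sequence. *)
Lemma basis_constant_subseq (K : R) (s : nat -> X) k : sincr k ->
  basis_constant K s -> basis_constant K (s \o k).
Proof.
move=> hk sK n m a nm.
pose b j := \sum_(i < m) (k i == j)%:R * a i.
have bE r : (r <= m)%N -> \sum_(i < r) a i *: s (k i) = \sum_(j < k r) b j *: s j.
  move=> rm; under [RHS]eq_bigr do rewrite scaler_suml.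
  rewrite exchange_big /= (big_ord_widen _ (fun i => a i *: s (k i)) rm) big_mkcond /=.
  apply: eq_bigr => i _; case: ltnP => [ir|ri].
    rewrite (bigD1 (Ordinal (sincr_lt hk ir))) //= eqxx mul1r big1 ?addr0 // => j.
    by rewrite -val_eqE eq_sym /= => /negPf ->; rewrite mul0r scale0r.
  rewrite big1 // => j _; rewrite (_ : _ == _ = false) ?mul0r ?scale0r //.
  have := ltn_ord j; have := sincr_le hk ri; lia.
rewrite /= (bE n nm) (bE m (leqnn m)); apply: sK.
exact: sincr_le.
Qed.

Lemma continuous_linear_bound (f : {linear X -> R^o}) : continuous f ->
  exists2 M : R, 0 < M & forall v, `|f v| <= M * `|v|.
Proof.
move=> fc; have /linear_boundedP/pinfty_ex_gt0[M M0 h] := (linear_bounded_continuous f).2 fc.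
by exists M.
Qed.

End WeaklyNull.

(** * Infinite sums of Krivine blocks *)

Section Blocks.
Context {R : realType} {X : normedModType R}.

Lemma big_ord_mul (V : zmodType) n P (F : nat -> nat -> V) : (0 < P)%N ->
  \sum_(j < n * P) F (j %/ P)%N (j %% P)%N = \sum_(i < n) \sum_(k < P) F i k.
Proof.
move=> P0; elim: n => [|n IH]; first by rewrite mul0n !big_ord0.
rewrite mulSnr big_split_ord /= IH big_ord_recr /=; congr (_ + _).
apply: eq_bigr => k _.
by rewrite divnMDl // modnMDl divn_small // modn_small // addn0.
Qed.

Lemma block_reindex_sincr P (q : nat -> nat) : (0 < P)%N ->
  (forall i, (q i + P <= q i.+1)%N) -> sincr (fun j => q (j %/ P) + j %% P)%N.
Proof.
move=> P0 qP j; have jE := divn_eq j P; have := ltn_pmod j P0.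
move: (j %/ P)%N (j %% P)%N jE => a b -> bP.
have dm e d : (d < P)%N -> ((e * P + d) %/ P = e)%N /\ ((e * P + d) %% P = d)%N.
  by move=> dP; rewrite divnMDl // modnMDl divn_small // modn_small // addn0.
have [bP'|bP'] := ltnP b.+1 P.
  have -> : (a * P + b).+1 = (a * P + b.+1)%N by rewrite addnS.
  by have [-> ->] := dm a _ bP'; lia.
have -> : ((a * P + b).+1 = a.+1 * P + 0)%N by rewrite mulSnr; lia.
by have [-> ->] := dm a.+1 _ P0; have := qP a; lia.
Qed.

Lemma glue (S : nat -> nat) (b : nat -> nat -> R) : sincr S ->
  exists a, forall n i, (S n <= i < S n.+1)%N -> a i = b n (i - S n)%N.
Proof.
move=> S_incr.
have S_le := sincr_le S_incr.
have h i : exists v : R, forall n, (S n <= i < S n.+1)%N -> v = b n (i - S n)%N.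
  have [[n nP]|no] := pselect (exists n, (S n <= i < S n.+1)%N).
    exists (b n (i - S n)%N) => n' n'P; suff -> : n = n' by [].
    have [nn'|nn'|//] := ltngtP n n'; first by have := S_le _ _ nn'; lia.
    by have := S_le _ _ nn'; lia.
  by exists 0 => n nP; case: no; exists n.
have [a aP] := choice h.
by exists a => n i; exact: aP.
Qed.

Lemma block_sequence_intro (x : nat -> X) (S Q : nat -> nat) (w : nat -> R) :
  (forall n, (0 < Q n)%N) -> (forall n, (S n + Q n <= S n.+1)%N) ->
  (forall n, \sum_(k < Q n) w k *: x (S n + k)%N != 0) ->
  block_sequence x (fun n => \sum_(k < Q n) w k *: x (S n + k)%N).
Proof.
move=> Q0 SQ yN0; have S_incr : sincr S by move=> n; have := Q0 n; have := SQ n; lia.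
have [a aP] := glue (fun n k => if (k < Q n)%N then w k else 0) S_incr.
exists S, a; split=> // n; split=> //.
rewrite -[X in \sum_(X <= _ < _) _]add0n big_addn big_mkord.
have QS : (Q n <= S n.+1 - S n)%N by have := SQ n; lia.
rewrite (big_ord_widen _ (fun k => w k *: x (S n + k)%N) QS) big_mkcond /=.
apply: eq_bigr => k _; have := ltn_ord k => kS.
rewrite (aP n); last by lia.
by rewrite addnK addnC; case: ifP => //; rewrite scale0r.
Qed.

Lemma cvg_sum_ord (T : Type) (F : set_system T) {FF : Filter F} n
  (f : nat -> T -> R) (l : nat -> R) : (forall k, f k @ F --> l k) ->
  (fun t => \sum_(k < n) f k t) @ F --> \sum_(k < n) l k.
Proof.
move=> fl; elim: n => [|n IH].
  rewrite big_ord0 (_ : (fun _ => _) = fun=> 0); first exact: cvg_cst.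
  by apply/funext => t; rewrite big_ord0.
rewrite big_ord_recr /= (_ : (fun _ => _) =
  (fun t => \sum_(k < n) f k t + f n t)); first exact: cvgD.
by apply/funext => t; rewrite big_ord_recr.
Qed.

Context (x : nat -> X) (N : nat -> (nat -> unit) -> (nat -> R) -> R).
Hypothesis xN : asymptotic_norm (fun _ : unit => x) N.

(** Combinations of far apart translates of one block [w] of length [P], seen as
    combinations of [n * P] terms with periodic coefficients. *)
Lemma block_sum_cvg n P (w : nat -> R) (q : (nat -> nat) -> nat -> nat) : (0 < P)%N ->
  (forall K, \forall l \near spread,
     (forall i, (q l i + P <= q l i.+1)%N) /\ (K <= q l 0%N)%N) ->
  (fun l => `|\sum_(i < n) \sum_(k < P) w k *: x (q l i + k)%N|) @ spread -->
  N (n * P) single (fun j => w (j %% P)%N).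
Proof.
move=> P0 hq.
have h : (fun l j => q l (j %/ P) + j %% P)%N @ spread --> spread.
  apply: spread_map => K; apply: filterS (hq K) => l [ql Kl].
  split; first exact: block_reindex_sincr.
  by rewrite div0n mod0n addn0.
have := @asym_comp _ _ _ _ _ xN (n * P) single (fun j => w (j %% P)%N) _ h.
suff -> : (fun l : nat -> nat => `|\sum_(i < n * P)
     w (i %% P)%N *: x (q l (i %/ P) + i %% P)%N|) =
   (fun l => `|\sum_(i < n) \sum_(k < P) w k *: x (q l i + k)%N|) by [].
apply/funext => l; congr `|_|.
exact: (@big_ord_mul X n P (fun i k => w k *: x (q l i + k)%N)).
Qed.

Lemma tail_limit n (a : nat -> R) e : 0 < e -> exists T, forall p, (T <= p)%N ->
  `| `|\sum_(i < n) a i *: x (p + i)%N| - N n single a| <= e.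
Proof.
move=> e0; have /cvgrPdist_le/(_ _ e0)[K _ hK] := @xN n single a.
exists K => p Kp; rewrite distrC; apply: (hK (fun i => p + i)%N) => /=.
by rewrite addn0; split=> // i; rewrite addnS.
Qed.

End Blocks.

Section KrivineBlocks.
Context {R : realType} {X : normedModType R}.
Context (x : nat -> X) (N : nat -> (nat -> unit) -> (nat -> R) -> R).
Hypothesis x_wn : weakly_null x.
Hypothesis xN : asymptotic_norm (fun _ : unit => x) N.
Let wn (u : unit) : weakly_null x := x_wn.

Section Construction.
(** The [r]-th block has length [mm r] and coefficients [la r]; its first [nn r]
    translates have an l_1 lower estimate.  The blocks, weighted by [2 ^ - r], are laid
    side by side in one coefficient sequence [w], the [r]-th one starting at [offset r],
    and [y j] uses the first [j.+1] blocks, placed in [x] from the index [S j] on. *)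
Context (nn mm : nat -> nat) (la : nat -> nat -> R).
Hypothesis mm0 : forall r, (0 < mm r)%N.
Hypothesis la_lb : forall r, 2^-1 <= N (mm r) single (la r).
Hypothesis la_ub : forall r, N (mm r) single (la r) <= 2.
Hypothesis la_l1 : forall r,
  2^-1 * (nn r)%:R <= N (nn r * mm r) single (fun j => la r (j %% mm r)%N).

Definition offset r := (\sum_(i < r) mm i)%N.
Local Notation P := offset.
Local Notation c r := (2^-1 ^+ r : R).
Definition krivine_vector r p : X := \sum_(k < mm r) la r k *: x (p + k)%N.

Local Notation z := krivine_vector.

Lemma half_pow_gt0 r : 0 < c r. Proof. by rewrite exprn_gt0 // invr_gt0. Qed.

Lemma offset_rec r : P r.+1 = (P r + mm r)%N. Proof. by rewrite /offset big_ord_recr. Qed.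

Lemma offset_incr : sincr P. Proof. by move=> r; rewrite offset_rec; have := mm0 r; lia. Qed.

Lemma exists_concat : exists w : nat -> R,
  forall r k, (k < mm r)%N -> w (P r + k)%N = c r * la r k.
Proof.
have [w wP] := glue (fun r k => c r * la r k) offset_incr; exists w => r k kr.
by rewrite (wP r) ?offset_rec; [rewrite addKn | lia].
Qed.

Context (w : nat -> R).
Hypothesis wP : forall r k, (k < mm r)%N -> w (P r + k)%N = c r * la r k.

Lemma concat_sum (V : lmodType R) R0 (v : nat -> V) :
  \sum_(k < P R0) w k *: v k = \sum_(r < R0) c r *: \sum_(k < mm r) la r k *: v (P r + k)%N.
Proof.
elim: R0 => [|r IH]; first by rewrite /offset !big_ord0.
rewrite offset_rec big_split_ord /= IH big_ord_recr /=; congr (_ + _).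
by rewrite scaler_sumr; apply: eq_bigr => k _; rewrite wP // scalerA.
Qed.

(** Since the norms of translates of a fixed block converge, the starts [S j] can be
    chosen such that all translates beyond them satisfy the estimates
    of the limit with slightly worse constants.  The lower bound comes from the 0-th
    block, which the monotonicity of the asymptotic norm keeps. *)
Lemma exists_starts : exists S : nat -> nat,
  (forall j, (S j + P j.+1 <= S j.+1)%N) /\
  forall j p, (S j <= p)%N ->
    (forall r, (r <= j)%N -> `|z r p| <= 3) /\
    4^-1 <= `|\sum_(k < P j.+1) w k *: x (p + k)%N|.
Proof.
have h1 r : exists T, forall p, (T <= p)%N -> `|z r p| <= 3.
  have [T hT] := tail_limit xN (mm r) (la r) ltr01.
  exists T => p /hT; rewrite ler_norml -/(krivine_vector r p) ; have := la_ub r; lra.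
have h2 j : exists T, forall p, (T <= p)%N -> 4^-1 <= `|\sum_(k < P j.+1) w k *: x (p + k)%N|.
  have e0 : 0 < 4^-1 :> R by rewrite invr_gt0.
  have [T hT] := tail_limit xN (P j.+1) w e0; exists T => p /hT.
  suff : 2^-1 <= N (P j.+1) single w by rewrite ler_norml; lra.
  have P1 : P 1 = mm 0 by rewrite /offset big_ord1.
  apply: le_trans (asym_mono xN wn single w (_ : (mm 0 <= P j.+1)%N)); last first.
    by rewrite -P1; apply: (sincr_le offset_incr).
  rewrite (asym_ext xN (t' := single) (a' := la 0%N)); first exact: la_lb.
  move=> i i0; split=> //; have := wP i0.
  by rewrite /offset big_ord0 add0n expr0 mul1r.
have [T1 T1P] := choice h1; have [T2 T2P] := choice h2.
pose S j := (\sum_(i < j.+1) (T1 i + T2 i + P i.+1))%N.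
exists S; split=> [j|j p Sp].
  rewrite {2}/S big_ord_recr /= -/(S j); have := offset_incr j.+1; lia.
have ge r : (r <= j)%N -> (T1 r + T2 r <= p)%N.
  move=> rj; apply: leq_trans Sp; rewrite /S (bigD1 (Ordinal (rj : (r < j.+1)%N))) //=; lia.
split=> [r rj|]; first by apply: T1P; have := ge r rj; lia.
by apply: T2P; have := ge j (leqnn j); lia.
Qed.

Context (S : nat -> nat).
Hypothesis S_gap : forall j, (S j + P j.+1 <= S j.+1)%N.
Hypothesis S_z : forall j p, (S j <= p)%N -> forall r, (r <= j)%N -> `|z r p| <= 3.
Hypothesis S_lb : forall j p, (S j <= p)%N -> 4^-1 <= `|\sum_(k < P j.+1) w k *: x (p + k)%N|.

Definition block_vector j : X := \sum_(k < P j.+1) w k *: x (S j + k)%N.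
Definition block_head R0 j : X := \sum_(k < P R0) w k *: x (S j + k)%N.
Local Notation y := block_vector.
Local Notation main := block_head.

Lemma offset_gt0 r : (0 < P r.+1)%N. Proof. by rewrite offset_rec; have := mm0 r; lia. Qed.

Lemma starts_incr : sincr S. Proof. by move=> j; have := S_gap j; have := offset_gt0 j; lia. Qed.

Lemma offset_le r s : (r <= s)%N -> (P r <= P s)%N.
Proof. exact: (sincr_le offset_incr). Qed.

(** The block [r] contributes at most [3 * 2 ^ - r]; the bound [6 * (2 ^ - R0 - 2 ^ - s)]
    makes the geometric sum telescope. *)
Lemma block_tail R0 j : (R0 <= j.+1)%N -> `|y j - main R0 j| <= 6 * c R0.
Proof.
move=> Rj; rewrite /block_vector /block_head !(concat_sum _ (fun k => x (S j + k)%N)).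
suff h s : (s <= j.+1)%N -> (R0 <= s)%N ->
    `|\sum_(r < s) c r *: \sum_(k < mm r) la r k *: x (S j + (P r + k))%N -
      \sum_(r < R0) c r *: \sum_(k < mm r) la r k *: x (S j + (P r + k))%N| <=
    6 * (c R0 - c s).
  by apply: le_trans (h _ (leqnn _) Rj) _; have := half_pow_gt0 j.+1; lra.
elim: s => [|s IH] sj.
  by rewrite leqn0 => /eqP ->; rewrite !subrr mulr0 normr0.
rewrite leq_eqVlt => /predU1P[<-|Rs]; first by rewrite !subrr mulr0 normr0.
rewrite big_ord_recr /= addrAC; apply: le_trans (ler_normD _ _) _.
have := IH (ltnW sj) Rs; rewrite normrZ (gtr0_norm (half_pow_gt0 s)).
have zE : \sum_(k < mm s) la s k *: x (S j + (P s + k))%N = z s (S j + P s)%N.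
  by apply: eq_bigr => k _; rewrite addnA.
rewrite zE; have := S_z (leq_addr (P s) (S j)) (sj : (s <= j)%N).
move/(ler_wpM2l (ltW (half_pow_gt0 s))); have -> : c s.+1 = c s / 2 by rewrite exprSr.
set u := `|_ - _|; move: (c s * `|z s _|) => v; lra.
Qed.

Lemma near_spaced kk R0 K : sincr kk -> \forall l \near spread,
  (forall i, (S (kk (l i)) + P R0 <= S (kk (l i.+1)))%N) /\ (K <= S (kk (l 0%N)))%N.
Proof.
move=> hk; apply: (near_spreadP (K := maxn K R0)) => l hl.
rewrite geq_max => /andP[Kl Rl]; split=> [i|]; last first.
  by have := sincr_ge (l 0%N) hk; have := sincr_ge (kk (l 0%N)) starts_incr; lia.
have h1 := sincr_lt hk (hl i); have h2 := sincr_add 0 i hl.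
have h3 := sincr_ge (l i) hk; rewrite add0n in h2.
have h4 : (S (kk (l i)).+1 <= S (kk (l i.+1)))%N by exact: sincr_le starts_incr _ _ h1.
have := S_gap (kk (l i)); have := @offset_le R0 (kk (l i)).+1; lia.
Qed.

Lemma block_head_cvg n R0 kk : (0 < R0)%N -> sincr kk ->
  (fun l : nat -> nat => `|\sum_(i < n) main R0 (kk (l i))|) @ spread -->
  N (n * P R0) single (fun j => w (j %% P R0)%N).
Proof.
case: R0 => // R0 _ hk.
exact: (@block_sum_cvg _ _ _ _ xN n _ w _ (offset_gt0 R0) (fun K => near_spaced R0.+1 K hk)).
Qed.

Lemma near_stage kk R0 : sincr kk -> \forall l \near spread,
  sincr l /\ forall i, (R0 <= (kk (l i)).+1)%N.
Proof.
move=> hk; apply: (near_spreadP (K := R0)) => l hl Rl; split=> // i.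
have := sincr_ge (l i) hk; have := sincr_add 0 i hl; rewrite add0n; lia.
Qed.

Lemma block_vector_bounds j : 4^-1 <= `|y j| <= 6.
Proof.
rewrite S_lb //=; have := block_tail (leq0n j.+1).
have P0 : P 0 = 0%N by rewrite /offset big_ord0.
by rewrite /block_head P0 big_ord0 subr0 expr0 mulr1.
Qed.

Lemma half_pow_small (d : R) : 0 < d -> exists r0, c r0 <= d.
Proof.
move=> d0; have : 2^-1 ^+ m @[m --> \oo] --> (0 : R).
  by apply: cvg_expr; rewrite ger0_norm ?invr_ge0 // invf_lt1 // ltr1n.
move/cvgrPdist_le => /(_ _ d0)[m _ /(_ m (leqnn m))].
by rewrite sub0r normrN (gtr0_norm (half_pow_gt0 m)) => h; exists m.
Qed.

(** The heads with a fixed number of blocks are combinations of finitely many weakly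
    null sequences, and the tails are uniformly small. *)
Lemma block_vector_weakly_null : weakly_null y.
Proof.
move=> f fc; have [M M0 fM] := continuous_linear_bound fc.
apply/cvgrPdist_le => e e0.
have d0 : 0 < e / 2 / (6 * M) by rewrite !divr_gt0 // mulr_gt0.
have [R0 hR] := half_pow_small d0.
have main0 : (fun j => f (main R0 j)) @ \oo --> (0 : R).
  have -> : (fun j => f (main R0 j)) =
      (fun j => \sum_(k < P R0) w k * f (x (S j + k)%N)).
    apply/funext => j; rewrite /block_head linear_sum; apply: eq_bigr => k _.
    by rewrite linearZ.
  have wx k : (fun j => w k * f (x (S j + k)%N)) @ \oo --> w k * (0 : R).
    apply: cvgM; first exact: cvg_cst.
    have Sk : sincr (fun j => S j + k)%N by move=> j; rewrite ltn_add2r starts_incr.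
    exact: (weakly_null_subseq Sk x_wn fc).
  have := cvg_sum_ord (n := P R0) wx.
  suff -> : \sum_(k < P R0) w k * (0 : R) = 0 by apply.
  by rewrite big1 // => k _; rewrite mulr0.
have e2 : 0 < e / 2 by rewrite divr_gt0.
have /cvgrPdist_le/(_ _ e2)[j0 _ hj0] := main0.
exists (maxn j0 R0) => // j /=; rewrite geq_max => /andP[jj0 jR].
have := hj0 j jj0; rewrite /= !sub0r !normrN => h1.
rewrite -(subrK (main R0 j) (y j)) linearD (splitr e).
apply: le_trans (ler_normD _ _) (lerD _ h1).
apply: le_trans (fM _) _; apply: le_trans (ler_wpM2l (ltW M0) (block_tail (leqW jR))) _.
by move: hR; rewrite ler_pdivlMr ?mulr_gt0 //; lra.
Qed.

Lemma block_vector_sequence kk : sincr kk -> block_sequence x (y \o kk).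
Proof.
move=> hk; apply: (@block_sequence_intro _ _ x (S \o kk) (fun n => P (kk n).+1) w).
- by move=> n; exact: offset_gt0.
- move=> n /=; apply: leq_trans (S_gap _) _.
  exact: (sincr_le starts_incr (hk n)).
- move=> n; rewrite -normr_gt0; case/andP: (block_vector_bounds (kk n)) => + _.
  by apply: lt_le_trans; rewrite invr_gt0.
Qed.

Context (kk : nat -> nat) (M : nat -> (nat -> unit) -> (nat -> R) -> R).
Hypothesis kk_incr : sincr kk.
Hypothesis yM : asymptotic_norm (fun _ : unit => y \o kk) M.

Lemma near_block_head n R0 : \forall l \near spread,
  `|\sum_(i < n) y (kk ((l : nat -> nat) i)) - \sum_(i < n) main R0 (kk (l i))| <= n%:R * (6 * c R0).
Proof.
apply: filterS (near_stage R0 kk_incr) => l [hl lR].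
rewrite -sumrB; apply: le_trans (ler_norm_sum _ _ _) _.
apply: le_trans (ler_sum _ (fun (i : 'I_n) _ => block_tail (lR i))) _.
by rewrite sumr_const card_ord -[_ *+ n]mulr_natl.
Qed.

Lemma block_norm_cvg n :
  (fun l : nat -> nat => `|\sum_(i < n) y (kk (l i))|) @ spread --> M n single (fun=> 1).
Proof.
suff -> : (fun l : nat -> nat => `|\sum_(i < n) y (kk (l i))|) =
    (fun l => `|\sum_(i < n) 1 *: (y \o kk) (l i)|) by exact: yM.
by apply/funext => l; congr `|_|; apply: eq_bigr => i _; rewrite scale1r.
Qed.

(** Up to the tails, a sum of [n] vectors [y] splits into [offset R0] sums of [n] terms of
    [x], one for each position of the head. *)
Lemma block_norm_upper n R0 : M n single (fun=> 1) <=
  (\sum_(k < P R0) `|w k|) * N n single (fun=> 1) + n%:R * (6 * c R0).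
Proof.
pose g k (l : nat -> nat) := `|w k| * `|\sum_(i < n) 1 *: x (S (kk (l i)) + k)%N|.
have g_cvg k : g k @ spread --> `|w k| * N n single (fun=> 1).
  apply: cvgM; first exact: cvg_cst.
  apply: (@asym_comp _ _ _ _ _ xN n single (fun=> 1) (fun l i => S (kk (l i)) + k)%N).
  apply: spread_map => K; apply: (near_spreadP (K := K)) => l hl Kl; split.
    by move=> i; rewrite ltn_add2r; apply: sincr_lt starts_incr _ _ (sincr_lt kk_incr (hl i)).
  by have := sincr_ge (l 0%N) kk_incr; have := sincr_ge (kk (l 0%N)) starts_incr; lia.
rewrite mulr_suml; apply: (le_lim (@block_norm_cvg n)
  (cvgD (@cvg_sum_ord R _ spread _ (P R0) g _ g_cvg) (cvg_cst (n%:R * (6 * c R0))))).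
apply: filterS (near_block_head n R0) => l /= h.
rewrite -(subrK (\sum_(i < n) main R0 (kk (l i))) (\sum_(i < n) y _)) addrC.
apply: le_trans (ler_normD _ _) (lerD _ h); rewrite /block_head exchange_big /=.
apply: le_trans (ler_norm_sum _ _ _) _; apply: ler_sum => k _.
rewrite /g -!scaler_sumr scale1r normrZ.
exact: lexx.
Qed.

(** Suppressing every block but the [r]-th leaves [2 ^ - r] times [nn r] translates of
    it, of norm at least [2 ^ - r * nn r / 2].  With [R0 = r + 5] the tails cost
    [6 * 2 ^ - R0 * nn r = (3 / 16) * 2 ^ - r * nn r], less than half of that. *)
Lemma block_norm_lower r : c r / 4 * (nn r)%:R <= M (nn r) single (fun=> 1).
Proof.
set n := nn r; pose R0 := (r + 5)%N.
have R00 : (0 < R0)%N by rewrite /R0; lia.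
have P0 : (0 < P R0)%N by rewrite /R0 addnS; exact: offset_gt0.
have h1 : c r * N (n * mm r) single (fun j => la r (j %% mm r)%N) <=
    N (n * P R0) single (fun j => w (j %% P R0)%N).
  pose w' k := if (P r <= k < P r.+1)%N then w k else 0.
  apply: le_trans (asym_suppress xN wn _ single _ (fun j => P r <= j %% P R0 < P r.+1)%N).
  rewrite le_eqVlt; apply/orP; left; apply/eqP.
  have q_ok K : \forall l \near spread,
      (forall i, (S (kk (l i)) + P r + mm r <= S (kk (l i.+1)) + P r)%N)
      /\ (K <= S (kk (l 0%N)) + P r)%N.
    apply: filterS (near_spaced r.+1 K kk_incr) => l [gap Kl]; rewrite offset_rec in gap.
    by split=> [i|]; [have := gap i; lia | exact: leq_trans Kl (leq_addr _ _)].
  have c1 := @block_sum_cvg _ _ _ _ xN n _ (la r) _ (mm0 r) q_ok.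
  have c2 := @block_sum_cvg _ _ _ _ xN n _ w' _ P0
    (fun K => near_spaced R0 K kk_incr).
  apply: (cvg_eq_lim (cvgM (cvg_cst (c r)) c1) c2) => l /=.
  rewrite -{1}(gtr0_norm (half_pow_gt0 r)) -normrZ; congr `|_|.
  rewrite scaler_sumr; apply: eq_bigr => i _.
  have PR : P R0 = (P r + (mm r + (P R0 - P r.+1)))%N.
    by have := @offset_le r.+1 R0; rewrite offset_rec /R0; lia.
  rewrite {}PR !big_split_ord /= [X in _ = X + _]big1 ?add0r; last first.
    by move=> k _; rewrite /w' leqNgt ltn_ord /= scale0r.
  rewrite [X in _ = _ + X]big1 ?addr0; last first.
    move=> k _; rewrite /w' (_ : (_ < P r.+1)%N = false) ?andbF ?scale0r //.
    by have := offset_rec r; lia.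
  rewrite scaler_sumr; apply: eq_bigr => k _.
  by rewrite scalerA -wP // /w' leq_addr offset_rec ltn_add2l ltn_ord addnA.
have h2 : N (n * P R0) single (fun j => w (j %% P R0)%N) <= M n single (fun=> 1) + n%:R * (6 * c R0).
  apply: (le_lim (@block_head_cvg n R0 kk R00 kk_incr) (cvgD (@block_norm_cvg n) (cvg_cst _))).
  apply: filterS (near_block_head n R0) => l /= h; rewrite addrC -lerBlDr.
  by apply: le_trans (lerB_dist _ _) _; rewrite distrC.
have h3 := ler_wpM2l (ltW (half_pow_gt0 r)) (la_l1 r).
have cR : c R0 = c r / 32.
  by rewrite /R0 exprD; congr (_ * _); rewrite !exprS expr0; lra.
rewrite cR in h2; rewrite -/n in h3.
have : 0 <= c r * n%:R by rewrite mulr_ge0 // ltW.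
move: h1 h2 h3; rewrite (mulrCA n%:R 6) (mulrA n%:R) (mulrC n%:R (c r)) mulrCA.
rewrite mulrAC; lra.
Qed.

End Construction.

(** The sequence behind both assertions.  Its lower estimates beat [lam] infinitely
    often because [nn r] is chosen with [nn r / lam (nn r) >= 4 * r * 2 ^ r]. *)
Theorem krivine_blocks (lam : nat -> R) :
  (forall n, (0 < n)%N -> exists m (la : nat -> R), [/\ (0 < m)%N,
     2^-1 <= N m single la <= 2 &
     2^-1 * n%:R <= N (n * m) single (fun j => la (j %% m)%N)]) ->
  (forall d : R, 0 < d -> exists n0, forall m, (n0 <= m)%N ->
     N m single (fun=> 1) <= d * m%:R) ->
  lam @ \oo --> +oo -> (fun n => n%:R / lam n) @ \oo --> +oo ->
  exists (y : nat -> X) M, [/\ block_sequence x y, weakly_null y,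
    forall n, 4^-1 <= `|y n| <= 6 & fast_asymptotic_norm (fun _ : unit => y) M] /\
    (forall d : R, 0 < d -> exists n0, forall m, (n0 <= m)%N ->
       M m single (fun=> 1) <= d * m%:R) /\
    forall (B : R) n0, exists n, [/\ (n0 <= n)%N, 0 < lam n & B * lam n <= M n single (fun=> 1)].
Proof.
move=> kriv sub lam_oo nlam_oo.
have step r : exists p : nat * (nat * (nat -> R)), [/\ (r < p.1)%N,
     0 < lam p.1 /\ r%:R * (4 * 2 ^+ r) <= p.1%:R / lam p.1,
     (0 < p.2.1)%N, 2^-1 <= N p.2.1 single p.2.2 <= 2 &
     2^-1 * p.1%:R <= N (p.1 * p.2.1) single (fun j => p.2.2 (j %% p.2.1)%N)].
  have [n1 _ h1] := nlam_oo [set u | r%:R * (4 * 2 ^+ r) <= u] (nbhs_pinfty_ge (num_real _)).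
  have [n2 _ h2] := lam_oo [set u | 0 < u] (nbhs_pinfty_gt (num_real _)).
  pose n := (maxn r (maxn n1 n2)).+1.
  have [m [la [m0 la2 lan]]] := kriv n isT.
  exists (n, (m, la)); split=> //=; first by rewrite /n; lia.
  by split; [apply: h2 | apply: h1]; rewrite /= /n; lia.
have [p pP] := choice step.
pose nn r := (p r).1; pose mm r := (p r).2.1; pose la r := (p r).2.2.
have mm0 r : (0 < mm r)%N by case: (pP r).
have la_lb r : 2^-1 <= N (mm r) single (la r) by case: (pP r) => _ _ _ /andP[].
have la_ub r : N (mm r) single (la r) <= 2 by case: (pP r) => _ _ _ /andP[].
have la_l1 r : 2^-1 * (nn r)%:R <= N (nn r * mm r) single (fun j => la r (j %% mm r)%N).
  by case: (pP r).
have [w wP] := exists_concat la mm0.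
have [S [S_gap SP]] := exists_starts mm0 la_lb la_ub wP.
have S_z j q h := (SP j q h).1; have S_lb j q h := (SP j q h).2.
pose y := block_vector mm w S.
have yb j : 4^-1 <= `|y j| <= 6 by apply: (block_vector_bounds wP S_z S_lb).
have [|kk [M [kk_incr fast]]] := @brunel_sucheston R X unit (fun _ => y) 6.
  by move=> _ k; case/andP: (yb k).
have fastM : fast_asymptotic_norm (fun _ : unit => y \o kk) M by exact: fast.
have yM := fast_asymptotic fastM.
exists (y \o kk), M; split; [split | split].
- exact: (block_vector_sequence mm0 wP S_gap S_z S_lb kk_incr).
- apply: weakly_null_subseq => //; exact: (block_vector_weakly_null mm0 wP S_gap S_z).
- by move=> n; exact: yb.
- by [].
- move=> d d0; have d12 : 0 < d / 12 by rewrite divr_gt0.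
  have [R0 hR] := half_pow_small d12.
  pose A := \sum_(k < offset mm R0) `|w k|.
  have A0 : 0 < A + 1 by rewrite ltr_wpDl // sumr_ge0.
  have [|n0 hn0] := sub (d / 2 / (A + 1)); first by rewrite !divr_gt0.
  exists n0 => m /hn0 h.
  apply: le_trans (block_norm_upper mm0 wP S_gap S_z kk_incr yM m R0) _.
  have m0 : 0 <= m%:R :> R by [].
  have h1 : A * N m single (fun=> 1) <= d / 2 * m%:R.
    have A0' : 0 <= A by exact: sumr_ge0.
    apply: le_trans (ler_wpM2l A0' h) _; rewrite mulrA ler_wpM2r //.
    rewrite mulrCA ger_pMr ?divr_gt0 // ler_pdivrMr // mul1r; lra.
  have h2 : m%:R * (6 * 2^-1 ^+ R0) <= d / 2 * m%:R.
    by rewrite mulrC ler_wpM2r //; lra.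
  rewrite -/A; lra.
move=> B n0; pose r := maxn n0 (Num.truncn B).+1.
exists (nn r); case: (pP r) => rn [lam0 h] _ _ _; split=> //.
  by rewrite /nn; have := rn; rewrite /r; lia.
have hM := block_norm_lower mm0 la_l1 wP S_gap S_z kk_incr yM r.
apply: le_trans hM.
have Br : B <= r%:R.
  by apply: ltW; apply: lt_le_trans (truncnS_gt _) _; rewrite ler_nat leq_maxr.
apply: le_trans (ler_wpM2r (ltW lam0) Br) _.
move: h; rewrite ler_pdivlMr // => h.
have c0 : 0 < 2^-1 ^+ r :> R by rewrite exprn_gt0 // invr_gt0.
have := ler_wpM2l (ltW c0) h.
have -> : 2^-1 ^+ r * (r%:R * (4 * 2 ^+ r) * lam (p r).1) = 4 * (r%:R * lam (p r).1) :> R.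
  have e1 : 2^-1 ^+ r * 2 ^+ r = 1 :> R by rewrite -exprMn mulVf // expr1n.
  have -> : 4 * (r%:R * lam (p r).1) = 2^-1 ^+ r * 2 ^+ r * (4 * (r%:R * lam (p r).1)) :> R.
    by rewrite e1 mul1r.
  by move: (2^-1 ^+ r) (2 ^+ r) => u v; ring.
rewrite -/(nn r); lra.
Qed.

End KrivineBlocks.

(** * Upper bounds and the main theorem *)

Lemma limn_esup_pinfty (R : realType) (u : nat -> R) :
  (forall (B : R) n0, exists2 n, (n0 <= n)%N & B <= u n) ->
  limn_esup (fun n => (u n)%:E) = +oo%E.
Proof.
move=> h; apply/eqP; rewrite -leye_eq; apply/ereal_infP => _ [V [n0 _ n0V] <-].
rewrite leye_eq; apply/eqP; apply: eq_infty => B.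
have [n n0n Bn] := h B n0.
apply: le_trans (_ : (u n)%:E <= _)%E; first by rewrite lee_fin.
by apply: ereal_sup_ubound => /=; exists n => //; exact: n0V.
Qed.

(** A unit vector of coefficients bounds the norm of one block, and the constant
    coefficients 1 bound the norm of the sum of its translates from below. *)
Lemma krivine_l1_blocks (R : realType) (E : normedModType R) (e : nat -> E) :
  krivine_set e 1%:E -> forall n, (0 < n)%N -> exists m (la : nat -> R), [/\ (0 < m)%N,
     2^-1 <= comb_asym e m single la <= 2 &
     2^-1 * n%:R <= comb_asym e (n * m) single (fun j => la (j %% m)%N)].
Proof.
move=> [_ kr] n n0; have [m [la [m0 h]]] := kr 1 ltr01 n n0.
exists m, (extend la); rewrite /comb_asym.
have two : 1 + 1 = 2 :> R by [].
have yE i : \sum_(k < m) la k *: e (i * m + k)%N = \sum_(k < m) extend la k *: e (i * m + k)%N.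
  by apply: eq_bigr => k _; rewrite extendE.
split=> //.
  have [] := h (fun i => (i == Ordinal n0)%:R).
  have -> : lp_norm 1%:E (fun i : 'I_n => (i == Ordinal n0)%:R : R) = 1.
    rewrite lp_norm1E (bigD1 (Ordinal n0)) //= ?eqxx normr1 big1 ?addr0 //.
    by move=> i /negPf ->; rewrite normr0.
  have pick (v : 'I_n -> E) : \sum_(i < n) (i == Ordinal n0)%:R *: v i = v (Ordinal n0).
    rewrite (bigD1 (Ordinal n0)) //= scale1r big1 ?addr0 // => i /negPf ->.
    by rewrite scale0r.
  by rewrite pick yE mul0n !mulr1 two => -> ->.
have [+ _] := h (fun=> 1); rewrite lp_norm1E two.
have -> : \sum_(i < n) `|1 : R| = n%:R.
  by under eq_bigr do rewrite normr1; rewrite sumr_const card_ord.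
move=> h1; apply: le_trans h1 _; rewrite le_eqVlt; apply/orP; left; apply/eqP.
congr `|_|.
transitivity (\sum_(i < n) \sum_(k < m) extend la k *: e (i * m + k)%N).
  by apply: eq_bigr => i _; rewrite scale1r yE.
rewrite -(@big_ord_mul E n m (fun i k => extend la k *: e (i * m + k)%N)) //.
by apply: eq_bigr => j _; rewrite -divn_eq.
Qed.

Section PairedSequences.
Context {R : realType} {X : normedModType R}.
Context (u v : nat -> X) (U V : nat -> (nat -> unit) -> (nat -> R) -> R).
Hypotheses (u_wn : weakly_null u) (v_wn : weakly_null v).
Hypotheses (uU : asymptotic_norm (fun _ : unit => u) U).
Hypotheses (vV : asymptotic_norm (fun _ : unit => v) V).

(** Terms of [u] and [v] are added in alternation along a subsequence [k] that makes the
    pair stable: [s j] uses [k (2j)] for [u] and [k (2j+1)] for [v].  A combination of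
    [n] terms of [s] is then one of [2n] terms with pattern [pat], and suppressing the
    odd or the even positions recovers [u] or [v]. *)
Theorem joint_upper_bound (B : R) :
  (forall n, `|u n| <= B) -> (forall n, `|v n| <= B) ->
  exists (s : nat -> X) N, [/\ weakly_null s, asymptotic_norm (fun _ : unit => s) N,
    forall n a, U n single a <= N n single a, forall n a, V n single a <= N n single a &
    forall n a, N n single a <= U n single a + V n single a].
Proof.
move=> uB vB.
pose x (b : bool) := if b then v else u.
have xB b n : `|x b n| <= B by case: b.
have x_wn b : weakly_null (x b) by case: b.
have [k [P [k_incr fast]]] := brunel_sucheston xB.
have xP : asymptotic_norm (fun b => x b \o k) P := fast_asymptotic fast.
have xk_wn b : weakly_null (x b \o k) by exact: weakly_null_subseq.
have d_incr c : sincr (fun j => j * 2 + c)%N by move=> j; lia.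
pose s j := u (k (j * 2)%N) + v (k (j * 2 + 1)%N).
pose pat (j : nat) := ((j %% 2)%N == 1%N).
pose N n (_ : nat -> unit) (a : nat -> R) := P (n * 2)%N pat (fun j => a (j %/ 2)%N).
have phi : (fun (l : nat -> nat) j => (l (j %/ 2) * 2 + j %% 2)%N) @ spread --> spread.
  apply: spread_map => K; apply: (near_spreadP (K := K)) => l hl Kl; split;
    last by rewrite div0n mod0n; lia.
  apply: (block_reindex_sincr (q := fun i => (l i * 2)%N)) => // i.
  by have := hl i; lia.
have pairE n (a : nat -> R) (w : bool -> nat -> X) (l : nat -> nat) :
    \sum_(j < n * 2) a (j %/ 2)%N *: w (pat j) (l (j %/ 2) * 2 + j %% 2)%N =
    \sum_(i < n) a i *: (w false (l i * 2)%N + w true (l i * 2 + 1)%N).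
  rewrite (@big_ord_mul _ n 2 (fun i c => a i *: w (c == 1%N) (l i * 2 + c)%N)) //.
  apply: eq_bigr => i _; rewrite big_ord_recr big_ord1 /= addn0.
  by rewrite scalerDr.
have Pcvg n (a : nat -> R) := @asym_comp _ _ _ _ _ xP (n * 2) pat a _ phi.
have sN : asymptotic_norm (fun _ : unit => s) N.
  move=> n t a.
  suff -> : (fun l : nat -> nat => `|\sum_(i < n) a i *: s (l i)|) =
     (fun l => `|\sum_(j < n * 2) a (j %/ 2)%N *: (x (pat j) \o k) (l (j %/ 2) * 2 + j %% 2)%N|).
    exact: Pcvg.
  by apply/funext => l; congr `|_|; rewrite (pairE n a (fun b => x b \o k) l).
have usub n (t : nat -> unit) (a : nat -> R) :
    (fun l : nat -> nat => `|\sum_(i < n) a i *: u (k (l i * 2)%N)|) @ spread --> U n t a.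
  have h : (fun (l : nat -> nat) => (fun i => k (i * 2 + 0)%N) \o l) @ spread --> spread.
    exact: (spread_comp (sincr_comp k_incr (d_incr 0%N))).
  have := @asym_comp _ _ _ _ _ uU n t a _ h.
  suff -> : (fun l : nat -> nat => `|\sum_(i < n) a i *: u (((fun i => k (i * 2 + 0)%N) \o l) i)|) =
     (fun l => `|\sum_(i < n) a i *: u (k (l i * 2)%N)|) by [].
  by apply/funext => l; congr `|_|; apply: eq_bigr => i _; rewrite /= addn0.
have vsub n (t : nat -> unit) (a : nat -> R) :
    (fun l : nat -> nat => `|\sum_(i < n) a i *: v (k (l i * 2 + 1)%N)|) @ spread --> V n t a.
  have h : (fun (l : nat -> nat) => (fun i => k (i * 2 + 1)%N) \o l) @ spread --> spread.
    exact: (spread_comp (sincr_comp k_incr (d_incr 1%N))).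
  exact: (@asym_comp _ _ _ _ _ vV n t a _ h).
have supp n (a : nat -> R) (b : bool) :
    (fun l : nat -> nat => `|\sum_(i < n) a i *: (x b \o k) (l i * 2 + b)%N|) @ spread -->
    P (n * 2)%N pat (fun j => if pat j == b then a (j %/ 2)%N else 0).
  have := Pcvg n (fun j => if pat j == b then a (j %/ 2)%N else 0).
  suff -> : (fun l : nat -> nat => `|\sum_(i < n * 2) (if pat i == b then a (i %/ 2)%N else 0) *:
        (x (pat i) \o k) (l (i %/ 2) * 2 + i %% 2)%N|) =
     (fun l => `|\sum_(i < n) a i *: (x b \o k) (l i * 2 + b)%N|) by [].
  apply/funext => l; congr `|_|.
  transitivity (\sum_(j < n * 2) a (j %/ 2)%N *:
      (if pat j == b then x (pat j) (k (l (j %/ 2) * 2 + j %% 2)%N) else 0)).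
    by apply: eq_bigr => j _; case: ifP => //; rewrite scale0r scaler0.
  rewrite (pairE n a (fun c j => if c == b then x c (k j) else 0) l).
  apply: eq_bigr => i _; case: (b) => /=; first by rewrite add0r.
  by rewrite addr0 addn0.
exists s, N; split=> //.
- move=> f fc.
  have hu := weakly_null_subseq (sincr_comp k_incr (d_incr 0%N)) u_wn fc.
  have hv := weakly_null_subseq (sincr_comp k_incr (d_incr 1%N)) v_wn fc.
  suff -> : (fun n => f (s n)) = (fun n => f ((u \o (k \o (fun j => j * 2 + 0)%N)) n) +
      f ((v \o (k \o (fun j => j * 2 + 1)%N)) n)).
    by rewrite -(addr0 (0 : R^o)); exact: cvgD hu hv.
  by apply/funext => n; rewrite /s linearD /= addn0.
- move=> n a; apply: le_trans (asym_suppress xP xk_wn _ pat _ (fun j => pat j == false)).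
  rewrite le_eqVlt; apply/orP; left; apply/eqP.
  apply: (cvg_eq_lim (usub n single a) (supp n a false)) => l.
  by congr `|_|; apply: eq_bigr => i _; rewrite /= addn0.
- move=> n a; apply: le_trans (asym_suppress xP xk_wn _ pat _ (fun j => pat j == true)).
  rewrite le_eqVlt; apply/orP; left; apply/eqP.
  by apply: (cvg_eq_lim (vsub n single a) (supp n a true)) => l.
- move=> n a; apply: (le_lim (sN n single a) (cvgD (usub n single a) (vsub n single a))).
  apply: nearW => l /=; under eq_bigr do rewrite scalerDr.
  by rewrite big_split ler_normD.
Qed.

End PairedSequences.

Section Normalization.
Context {R : realType} {X : normedModType R}.

(** The norms of the terms converge to [rho], so dividing by them amounts
    asymptotically to dividing by [rho].  The first [J] terms are dropped because they
    may vanish. *)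
Lemma normalize_weakly_null (s : nat -> X) (N : nat -> (nat -> unit) -> (nat -> R) -> R) rho :
  weakly_null s -> asymptotic_norm (fun _ : unit => s) N -> N 1%N single (fun=> 1) = rho ->
  0 < rho -> exists s' : nat -> X, [/\ normalized s', weakly_null s' &
    asymptotic_norm (fun _ : unit => s') (fun n t a => N n t a / rho)].
Proof.
move=> s_wn sN N1 rho0.
have s_rho e : 0 < e -> exists J, forall j, (J <= j)%N -> `|rho - `|s j| | <= e.
  move=> e0; have [J hJ] := tail_limit sN 1 (fun=> 1) e0; exists J => j Jj.
  by have := hJ j Jj; rewrite N1 big_ord1 scale1r addn0 distrC.
have [J hJ] := s_rho (rho / 2) (divr_gt0 rho0 (ltr0Sn _ 1)).
have sJ j : rho / 2 <= `|s (J + j)%N|.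
  by have := hJ _ (leq_addr j J); rewrite ler_norml; lra.
have rho2 : 0 < rho / 2 by rewrite divr_gt0.
have sJ0 j : 0 < `|s (J + j)%N| := lt_le_trans rho2 (sJ j).
have J_incr : sincr (fun j => J + j)%N by move=> j; rewrite addnS.
exists (fun j => `|s (J + j)%N|^-1 *: s (J + j)%N); split.
- by move=> j; rewrite normrZ normfV normr_id mulVf // gt_eqF.
- move=> f fc; apply/cvgrPdist_le => e e0.
  have e1 : 0 < e * (rho / 2) by rewrite mulr_gt0.
  have /cvgrPdist_le/(_ _ e1)[m _ hm] := weakly_null_subseq J_incr s_wn fc.
  exists m => // j /hm; rewrite /= !sub0r !normrN linearZ /= => h.
  rewrite normrM normfV normr_id ler_pdivrMl // mulrC; apply: le_trans h _.
  by rewrite ler_wpM2l // ltW.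
move=> n t a.
have main := @asym_comp _ _ _ _ _ sN n t a _ (spread_comp J_incr).
apply/cvgrPdist_le => e e0; have e2 : 0 < e / 2 by rewrite divr_gt0.
pose A := \sum_(i < n) `|a i|.
have A0 : 0 <= A by exact: sumr_ge0.
have A1 : 0 < A + 1 by rewrite ltr_wpDl.
have [K hK] := s_rho (e / 2 * rho / (A + 1)) ltac:(by rewrite !divr_gt0 ?mulr_gt0).
have er : 0 < e / 2 * rho by rewrite mulr_gt0.
have /cvgrPdist_le/(_ _ er) := main.
move=> h; apply: filterS (filterI h (near_spread K)) => l [/= h1 [hl Kl]].
set w := \sum_(i < n) _ *: s _ in h1.
have -> : N n t a / rho - `|\sum_(i < n) a i *: (`|s (J + l i)%N|^-1 *: s (J + l i)%N)| =
   (N n t a - `|w|) / rho + (`|rho^-1 *: w| -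
    `|\sum_(i < n) a i *: (`|s (J + l i)%N|^-1 *: s (J + l i)%N)|).
  by rewrite normrZ normfV (gtr0_norm rho0); field; rewrite gt_eqF.
rewrite (splitr e); apply: le_trans (ler_normD _ _) _; apply: lerD.
  by rewrite normrM normfV (gtr0_norm rho0) ler_pdivrMr.
apply: le_trans (ler_dist_dist _ _) _.
rewrite /w scaler_sumr -sumrB; apply: le_trans (ler_norm_sum _ _ _) _.
apply: le_trans (_ : \sum_(i < n) `|a i| * (e / 2 / (A + 1)) <= _); last first.
  by rewrite -mulr_suml -/A mulrCA ger_pMr // ler_pdivrMr // mul1r lerDl.
apply: ler_sum => i _; rewrite !scalerA -scalerBl normrZ.
have -> : rho^-1 * a i - a i * `|s (J + l i)%N|^-1 =
   a i * ((`|s (J + l i)%N| - rho) / rho) * `|s (J + l i)%N|^-1.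
  by field; rewrite !gt_eqF.
rewrite !normrM !normfV normr_id divfK ?gt_eqF // (gtr0_norm rho0) ler_wpM2l //.
rewrite ler_pdivrMr // distrC mulrAC; apply: hK.
by have := sincr_add 0 i hl; rewrite add0n; lia.
Qed.

Lemma asym_unique (s : nat -> X) N N' : asymptotic_norm (fun _ : unit => s) N ->
  asymptotic_norm (fun _ : unit => s) N' -> forall n t a, N n t a = N' n t a.
Proof. by move=> sN sN' n t a; exact: cvg_eq_lim (sN n t a) (sN' n t a) _. Qed.

Theorem normalized_basic_realization (s : nat -> X)
    (N : nat -> (nat -> unit) -> (nat -> R) -> R) :
  normalized s -> weakly_null s -> asymptotic_norm (fun _ : unit => s) N ->
  exists s' : nat -> X, [/\ normalized s', weakly_null s', basic_sequence s' &
    exists (F : completeNormedModType R) (f : nat -> F), spreading_model s' f /\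
      forall n (a : nat -> R), `|\sum_(i < n) a i *: f i| = N n single a].
Proof.
move=> s1 s_wn sN.
have [k [k_incr sk]] := basic_subsequence s1 s_wn.
have [|k' [M [k'_incr fast]]] := @brunel_sucheston R X unit (fun=> s \o k) 1.
  by move=> _ j; rewrite /= s1.
have hk : sincr (k \o k') by exact: sincr_comp.
have fastM : fast_asymptotic_norm (fun _ : unit => s \o (k \o k')) M by exact: fast.
have s'1 : normalized (s \o (k \o k')) by move=> j; exact: s1.
have s'_wn : weakly_null (s \o (k \o k')) by exact: weakly_null_subseq.
exists (s \o (k \o k')); split=> //.
  apply: (@basis_constant_basic _ _ _ 2 1) => // [|i]; last by rewrite s'1.
  exact: (basis_constant_subseq k'_incr sk).
have [|F [f [sf fM]]] := spreading_model_exists (c := 1) (C := 1) s'_wn ltr01 _ fastM.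
  by move=> j; rewrite s'1 lexx.
exists F, f; split=> // n a; rewrite fM.
apply: (asym_unique (fast_asymptotic fastM)).
exact: (asymptotic_subseq hk sN).
Qed.

End Normalization.

Theorem proposition3p6 (R : realType) (X E : completeNormedModType R)
    (x : nat -> X) (xt : nat -> E)
    (x_normalized : normalized x)
    (x_weakly_null : weakly_null x)
    (x_spreading : spreading_model x xt)
    (xt_not_l1 : ~ equivalent_l1 xt)
    (xt_krivine : krivine_set xt 1%:E) :
  (forall lam : nat -> R,
     (forall m n, (m <= n)%N -> lam m <= lam n) ->
     lam @ \oo --> +oo ->
     (fun n => n%:R / lam n) @ \oo --> +oo ->
     exists y : nat -> X, block_sequence x y /\
     exists (F : completeNormedModType R) (yt : nat -> F),
       spreading_model y yt /\
       limn_esup (fun n => (n%:R / `|\sum_(i < n) yt i|)%:E) = +oo%E /\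
       limn_esup (fun n => (`|\sum_(i < n) yt i| / lam n)%:E) = +oo%E) /\
  ~ (exists (E' : completeNormedModType R) (e : nat -> E'),
       maximal_spreading_model X e).
Proof.
have xN := spreading_model_asymptotic x_spreading.
have ones (V : normedModType R) (e : nat -> V) m :
    comb_asym e m single (fun=> 1) = `|\sum_(i < m) e i|.
  by rewrite /comb_asym; under eq_bigr do rewrite scale1r.
have x_sub d : 0 < d -> exists n0, forall m, (n0 <= m)%N ->
    comb_asym xt m single (fun=> 1) <= d * m%:R.
  move=> d0; have [n0 h] := not_l1_sublinear x_weakly_null xN xt_not_l1 d0.
  by exists n0 => m /h; rewrite ones.
have blocks lam := krivine_blocks (lam := lam) x_weakly_null xN
  (krivine_l1_blocks xt_krivine) x_sub.
split=> [lam _ lam_oo nlam_oo|].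
  have [y [M [[y_block y_wn y_bd fast] [M_sub M_large]]]] := blocks lam lam_oo nlam_oo.
  have y4 : 0 < 4^-1 :> R by rewrite invr_gt0.
  have [F [yt [y_yt ytM]]] := spreading_model_exists y_wn y4 y_bd fast.
  have ytE n : `|\sum_(i < n) yt i| = M n single (fun=> 1).
    by rewrite -ytM; under [in RHS]eq_bigr do rewrite scale1r.
  have y_lb n : 4^-1 <= `|y n| by case/andP: (y_bd n).
  exists y; split=> //; exists F, yt; split=> //; split; apply: limn_esup_pinfty => B n0.
    have B0 : 0 < `|B| + 1 by rewrite ltr_wpDl.
    have [|n1 h1] := M_sub (`|B| + 1)^-1; first by rewrite invr_gt0.
    exists (maxn n0 n1).+1; first by lia.
    have Mn0 := asym_ge_coord y_wn (fast_asymptotic fast) (ltW y4) y_lb single (fun=> 1)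
      (ltn0Sn (maxn n0 n1)).
    rewrite normr1 mulr1 in Mn0; rewrite ytE ler_pdivlMr; last exact: lt_le_trans Mn0.
    have := h1 (maxn n0 n1).+1; rewrite ler_pdivlMl // => /(_ _)h.
    apply: le_trans (h _); last by lia.
    rewrite ler_wpM2r //; first by apply: le_trans Mn0; exact: ltW.
    by apply: le_trans (ler_norm _) _; rewrite lerDl.
  have [n [n0n lam0 h]] := M_large B n0; exists n => //.
  by rewrite ytE ler_pdivlMr.
move=> [E' [e [[[x' [x'1 [x'_wn [_ x'_e]]]] e_l1] e_max]]].
have x'N := spreading_model_asymptotic x'_e.
have e_sub := not_l1_sublinear x'_wn x'N e_l1.
pose phi n := comb_asym e n single (fun=> 1).
(* The square root keeps [lam] unbounded when [phi] is bounded. *)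
pose lam n : R := phi n + Num.sqrt n%:R.
have phi0 n : 0 <= phi n by exact: normr_ge0.
have sqrt_large (A : R) : exists n0, forall n, (n0 <= n)%N -> A <= Num.sqrt n%:R.
  exists (Num.truncn (A ^+ 2)).+1 => n hn; apply: le_trans (ler_norm _) _.
  rewrite -sqrtr_sqr ler_wsqrtr //; apply: ltW; apply: lt_le_trans (truncnS_gt _) _.
  by rewrite ler_nat.
have lam_oo : lam @ \oo --> +oo.
  apply/cvgryPge => A; have [n0 h] := sqrt_large A; exists n0 => // n /= /h hA.
  by rewrite /lam; have := phi0 n; lra.
have nlam_oo : (fun n => n%:R / lam n) @ \oo --> +oo.
  apply/cvgryPge => A; pose A' := `|A| + 1.
  have A'0 : 0 < A' by rewrite ltr_wpDl.
  have [n1 h1] := e_sub (A'^-1 / 2) ltac:(by rewrite divr_gt0 // invr_gt0).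
  have [n2 h2] := sqrt_large (2 * A').
  exists (maxn n1 n2).+1 => // n /= hn.
  have sn0 : 0 < Num.sqrt n%:R :> R.
    by rewrite sqrtr_gt0 ltr0n; lia.
  have lam0 : 0 < lam n by rewrite /lam ltr_wpDl.
  have {}h2 : 2 * A' <= Num.sqrt n%:R by apply: h2; lia.
  have {}h1 : phi n <= A'^-1 / 2 * n%:R by rewrite /phi ones; apply: h1; lia.
  apply: le_trans (_ : A' <= _).
    by apply: le_trans (ler_norm _) _; rewrite lerDl.
  rewrite ler_pdivlMr // /lam mulrDr.
  have h3 : A' * phi n <= n%:R / 2.
    apply: le_trans (ler_wpM2l (ltW A'0) h1) _.
    by rewrite !mulrA divff ?gt_eqF // mul1r mulrC.
  have h4 : A' * Num.sqrt n%:R <= n%:R / 2.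
    have -> : n%:R / 2 = Num.sqrt n%:R / 2 * Num.sqrt n%:R :> R.
      by rewrite mulrAC -expr2 sqr_sqrtr.
    by apply: (ler_wpM2r (ltW sn0)); lra.
  lra.
have [y [M [[y_block y_wn y_bd fast] [M_sub M_large]]]] := blocks lam lam_oo nlam_oo.
have [||s [N [s_wn sN eN MN Ne]]] := joint_upper_bound x'_wn y_wn x'N (fast_asymptotic fast) (B := 6).
- by move=> n; rewrite x'1; lra.
- by move=> n; case/andP: (y_bd n).
pose rho := N 1%N single (fun=> 1).
have rho1 : 1 <= rho.
  apply: le_trans (eN 1%N (fun=> 1)).
  have x'1' n : 1 <= `|x' n| by rewrite x'1.
  have := asym_ge_coord x'_wn x'N ler01 x'1' single (fun=> 1) (ltn0Sn 0).
  by rewrite normr1 mulr1.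
have rho0 : 0 < rho by apply: lt_le_trans rho1.
have [s1 [s1_n s1_wn s1_N]] := normalize_weakly_null s_wn sN erefl rho0.
have [s2 [s2_n s2_wn s2_b [F [f [s2_f fN]]]]] := normalized_basic_realization s1_n s1_wn s1_N.
have f_l1 : ~ equivalent_l1 f.
  move=> [[C [C1 hC]] _].
  have C0 : 0 < C by apply: lt_le_trans C1.
  pose d := (4 * C)^-1.
  have d0 : 0 < d by rewrite invr_gt0 mulr_gt0.
  have [n1 h1] := e_sub d d0; have [n2 h2] := M_sub d d0.
  pose n := (maxn n1 n2).+1.
  have := hC n (fun=> 1); rewrite lp_norm1E.
  have -> : \sum_(i < n) `|1 : R| = n%:R.
    by under eq_bigr do rewrite normr1; rewrite sumr_const card_ord.
  rewrite /comb_norm (fN n (fun=> 1)) -/rho; apply/negP; rewrite -ltNge.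
  have {}h1 : phi n <= d * n%:R by rewrite /phi ones; apply: h1; rewrite /n; lia.
  have {}h2 : M n single (fun=> 1) <= d * n%:R by apply: h2; rewrite /n; lia.
  have h3 : N n single (fun=> 1) / rho <= N n single (fun=> 1).
    rewrite ler_pdivrMr // ler_peMr //; exact: asym_ge0 sN _ _ _.
  have h4 : N n single (fun=> 1) <= 2 * (d * n%:R).
    by apply: le_trans (Ne n _) _; rewrite -/(phi n); lra.
  apply: le_lt_trans (ler_wpM2l (ltW C0) (le_trans h3 h4)) _.
  have -> : C * (2 * (d * n%:R)) = n%:R / 2 by rewrite /d; field; rewrite gt_eqF.
  have : 0 < n%:R :> R by rewrite ltr0n.
  lra.
apply: (e_max F f).
  by split=> //; exists s2.
split.
  exists (1 + rho); split; first by rewrite lerDl ltW.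
  move=> n a; rewrite /comb_norm.
  have -> : \sum_(i < n) a i *: e i = \sum_(i < n) extend a i *: e i.
    by apply: eq_bigr => i _; rewrite extendE.
  have -> : \sum_(i < n) a i *: f i = \sum_(i < n) extend a i *: f i.
    by apply: eq_bigr => i _; rewrite extendE.
  rewrite fN; apply: le_trans (eN n (extend a)) _.
  rewrite mulrDl mul1r mulrCA -/rho divff ?gt_eqF // mulr1 lerDr divr_ge0 ?(ltW rho0) //.
  exact: asym_ge0 sN _ _ _.
move=> [C [C1 hC]].
have C0 : 0 < C by apply: lt_le_trans C1.
have [n [_ lam0 h]] := M_large (rho * C + 1) 0%N.
have := hC n (fun=> 1); rewrite /comb_norm (fN n (fun=> 1)) -/rho ler_pdivrMr //.
rewrite -/(comb_asym e n single (fun=> 1)) -/(phi n) => h1.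
have h2 := MN n (fun=> 1).
have h3 : C * phi n * rho <= C * lam n * rho.
  rewrite ler_wpM2r ?(ltW rho0) // ler_wpM2l ?(ltW C0) //.
  by rewrite /lam lerDl sqrtr_ge0.
lra.
Qed.
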